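(* Let $g(u)=\sum_{m\ge1}g_mu^m$ be an entire function with $g(0)=0$ and $g'(0)=1$. Assume that $g$ is odd and that its coefficients satisfy $$|g_{m}| \leq \frac{\alpha^{m-1}}{m!}$$ for all $m$, with some $\alpha > 0$. Let $\varepsilon\in(0,1)$ be real and fixed. Then the equation $$v_{\tau\tau} + v -\varepsilon^{2}(v_{\tau\tau}+v_{\xi\xi})+\sum_{m=2}^{\infty} g_{m} v^{m} = 0$$ has a solution given by a series $$\sum_{l=1}^{\infty} u_{l}(\tau, \varepsilon)\, e^{-l\xi}$$ convergent in the same domain as the corresponding series (the one with the same first coefficient $u_1$) for the equation in which $g_{m}$ is replaced by $\alpha^{m-1}/m!$ for every odd $m$, i.e. in which $g(u)$ is replaced by $\sinh(\alpha u)/\alpha$.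
   Context: The equation is obtained from $u_{tt}-u_{xx}+g(u)=0$ by setting $\xi=\varepsilon x$, $\tau=\sqrt{1-\varepsilon^2}\,t$; the coefficients $g_m$ are real, and the coefficients $u_l(\tau,\varepsilon)$ are $2\pi$-periodic in $\tau$. The corresponding series for $\sinh(\alpha u)/\alpha$ is the expansion $\sum_{l\ge1}\bar u_l(\tau,\varepsilon)e^{-l\xi}$ in increasing powers of $e^{-\xi}$ of $$u_{SHG}=\frac{4i}{\alpha}\arctan\left(\frac{\varepsilon}{\sqrt{1-\varepsilon^{2}}}\,\frac{\cos\tau}{i\sinh\xi}\right),$$ whose first coefficient is $\bar u_1=\dfrac{8\varepsilon}{\alpha\sqrt{1-\varepsilon^2}}\cos\tau$; ''the same first coefficient'' thus means $u_1=\bar u_1$. For fixed $\varepsilon$, the domain of convergence is understood as the (open) set of real $\xi$ for which the series converges for all real $\tau$. The conclusion is that $\sum_l u_l e^{-l\xi}$ converges, and its sum solves the equation, for all $\xi$ in the domain of convergence of $\sum_l\bar u_le^{-l\xi}$ and all real $\tau$. *)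

(* Defs.v *)
From Stdlib Require Import Reals.
From Coquelicot Require Import Coquelicot.
Open Scope R_scope.

(* Principal argument, in (-PI, PI] for z <> 0. *)
Definition Carg (z : C) : R :=
  if Rle_dec 0 (Im z) then acos (Re z / Cmod z) else - acos (Re z / Cmod z).

Definition Clog (z : C) : C := (ln (Cmod z), Carg z).

Definition Carctan (z : C) : C :=
  (/ (2 * Ci) * (Clog (1 + Ci * z) - Clog (1 - Ci * z)))%C.

Definition u_SHG (alpha eps tau xi : R) : C :=
  (4 * Ci / RtoC alpha *
   Carctan (RtoC (eps / sqrt (1 - eps ^ 2)) *
            (RtoC (cos tau) / (Ci * RtoC (sinh xi)))))%C.

(* A sequence of coefficients w : nat -> R -> R stands for the series
   sum_{l >= 1} w l tau * e^{- l xi}; the value w 0 is never used. *)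
Definition exp_term (w : nat -> R -> R) (tau xi : R) (n : nat) : R :=
  w (S n) tau * exp (- INR (S n) * xi).

Definition exp_sum (w : nat -> R -> R) (tau xi : R) : R :=
  Series (exp_term w tau xi).

Definition convergence_domain (w : nat -> R -> R) (xi : R) : Prop :=
  forall tau : R, ex_series (exp_term w tau xi).

(* For each tau, an expansion in increasing powers of e^{-xi} is an identity
   near xi = +oo; it determines w l tau for every l >= 1. *)
Definition is_exp_expansion (w : nat -> R -> R) (f : R -> R -> C) : Prop :=
  forall tau : R, Rbar_locally p_infty (fun xi =>
    exists s : R, is_series (exp_term w tau xi) s /\ f tau xi = RtoC s).

(* Both derivatives of order one are required explicitly because
   [ex_derive_n f 2 x] only says that [Derive f], which is total, is
   differentiable at x. *)
Definition solves_at (eps : R) (g : nat -> R) (v : R -> R -> R)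
    (tau xi : R) : Prop :=
  let v_tt := Derive_n (fun t => v t xi) 2 tau in
  let v_xx := Derive_n (fun x => v tau x) 2 xi in
  (ex_derive (fun t => v t xi) tau /\ ex_derive_n (fun t => v t xi) 2 tau) /\
  (ex_derive (fun x => v tau x) xi /\ ex_derive_n (fun x => v tau x) 2 xi) /\
  v_tt + v tau xi - eps ^ 2 * (v_tt + v_xx)
    + Series (fun m => g (m + 2)%nat * v tau xi ^ (m + 2)) = 0.

(* Main.v *)
(* Write q = exp (- xi), c = cos tau and look for u_l as a polynomial in c with odd
   powers k <= l. At order c^k q^l the equation expresses the coefficient p_{l,k} as
   (a nonlinear term in lower orders in q, plus a positive multiple of p_{l,k+2}),
   divided by (1 - eps^2) k^2 + eps^2 l^2 - 1, which is positive for l >= 2, k >= 1: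
   there are no small divisors and every sign is favourable. Hence the coefficients for
   the sinh equation are nonnegative and majorize those for g, and at tau = 0 the
   majorant series is the ubar series itself.
   The majorant is explicit: u_SHG = phi (c w) with phi y = 2/alpha ln ((1+y)/(1-y)),
   w = b / sinh xi and b = eps / sqrt (1 - eps^2), so that its coefficients are
   P_{l,k} = phi_k [q^l] w^k. That they satisfy the recursion reduces to two one-variable
   identities, sinh (alpha phi) / alpha = (y d/dy)^2 phi and
   b^2 (l^2 - k^2) [q^l] w^k = k (k+1) [q^l] w^(k+2). *)
Require Import Defs.
From Stdlib Require Import Reals Factorial Lra Lia Arith.
From Coquelicot Require Import Coquelicot.
Open Scope R_scope.

(** * Composition of series *)

(** Oddness of [g] removes the resonances. At [k = 0] the divisor is [eps ^ 2 * INR l ^ 2 - 1],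
    which may be negative or zero, but an odd nonlinearity acting on odd powers of [cos tau]
    produces no even power. The other zero divisor, [l = k = 1], is what leaves [u_1] free. The
    hypothesis gives mere convergence at [xi], whereas the equation needs two derivatives of the sum
    there. The room comes from the logarithmic singularity of [phi] at 1: the majorant sum is
    unbounded as [w] tends to 1, so convergence at [q] forces convergence at some larger [r].
    Everything is then dominated by the terms [l ^ 2 * M l * q ^ l], where [M l] is the majorant
    coefficient at [tau = 0]: the degree [k <= l] controls the first [tau]-derivative, the exact
    value [(k ^ 2 - 1) * P l k] of the sinh nonlinearity controls the nonlinear term, and the
    equation itself controls the second [tau]-derivative. *)

Lemma ex_series_dom (a b : nat -> R) :
  (forall n, Rabs (a n) <= b n) -> ex_series b -> ex_series a.
Proof. exact (@ex_series_le R_AbsRing R_CompleteNormedModule a b). Qed.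

Lemma series_tail (B : nat -> R) (e : R) :
  ex_series B -> 0 < e -> exists M, Series (fun k => B (S M + k)%nat) < e.
Proof.
  intros HB He.
  assert (H := Series_correct _ HB).
  apply is_series_Reals in H.
  destruct (H e He) as [M HM].
  exists M.
  specialize (HM M (le_n M)).
  rewrite (Series_incr_n B (S M)) in HM; [|lia|exact HB].
  simpl Init.Nat.pred in HM.
  unfold Rdist in HM.
  apply Rabs_def2 in HM.
  simpl in *; lra.
Qed.

(** Dominated convergence for series along any filter. It is applied to partial sums in
    [is_series_ps_comp] and to difference quotients in [is_derive_Series_dom]. *)
Lemma filterlim_Series_dom {T : Type} (F : (T -> Prop) -> Prop)
    {FF : ProperFilter F} (f : T -> nat -> R) (l B : nat -> R) :
  (forall m, filterlim (fun t => f t m) F (locally (l m))) ->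
  F (fun t => forall m, Rabs (f t m) <= B m) ->
  ex_series B ->
  filterlim (fun t => Series (f t)) F (locally (Series l)).
Proof.
  intros Hl HB EB.
  assert (HlB : forall m, Rabs (l m) <= B m).
  { intros m.
    assert (L : Rbar_le (Rabs (l m)) (B m)); [|exact L].
    apply (@filterlim_le T F _ (fun t => Rabs (f t m)) (fun _ => B m)).
    - revert HB; apply filter_imp; intros t Ht; apply Ht.
    - refine (filterlim_comp _ _ _ _ Rabs _ _ _ (Hl m) _).
      apply continuous_Rabs.
    - apply filterlim_const. }
  apply filterlim_locally; intros eps.
  (* The tail of the difference is at most twice that of [B]; [eps / 4] thus leaves [eps / 2] for
     the finitely many head terms. *)
  destruct (series_tail B (eps / 4) EB) as [M HM].
  { destruct eps as [e He]; simpl; lra. }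
  assert (HS : forall N (d : posreal),
    F (fun t => sum_f_R0 (fun m => Rabs (f t m - l m)) N < d)).
  { induction N as [|N IH]; intros d.
    - simpl. generalize (proj1 (filterlim_locally _ _) (Hl 0%nat) d).
      apply filter_imp; intros t Ht; exact Ht.
    - set (d2 := pos_div_2 d).
      generalize (filter_and _ _ (IH d2)
        (proj1 (filterlim_locally _ _) (Hl (S N)) d2)).
      apply filter_imp; intros t [H1 H2].
      change (Rabs (f t (S N) - l (S N)) < d2) in H2.
      simpl sum_f_R0. unfold d2 in *; simpl in *; lra. }
  generalize (filter_and _ _ HB (HS M (pos_div_2 eps))).
  apply filter_imp; intros t [Ht1 Ht2].
  change (Rabs (Series (f t) - Series l) < eps).
  assert (E1 : ex_series (f t)) by (apply ex_series_dom with B; auto).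
  assert (E2 : ex_series l) by (apply ex_series_dom with B; auto).
  rewrite <- Series_minus by assumption.
  assert (D : forall m, Rabs (f t m - l m) <= 2 * B m).
  { intros m. specialize (Ht1 m). specialize (HlB m).
    unfold Rminus. eapply Rle_trans; [apply Rabs_triang|].
    rewrite Rabs_Ropp; lra. }
  assert (E3 : ex_series (fun m => 2 * B m)) by exact (ex_series_scal_l (V:=R_NormedModule) 2 B EB).
  assert (E4 : ex_series (fun m => Rabs (f t m - l m))).
  { apply ex_series_dom with (2 := E3). intros m; rewrite Rabs_Rabsolu; apply D. }
  eapply Rle_lt_trans; [apply Series_Rabs; exact E4|].
  rewrite (Series_incr_n _ (S M)); [|lia|exact E4].
  assert (L : Series (fun k => Rabs (f t (S M + k)%nat - l (S M + k)%nat))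
     <= Series (fun k => 2 * B (S M + k)%nat)).
  { apply Series_le.
    - intros k; split; [apply Rabs_pos|apply D].
    - apply (proj1 (ex_series_incr_n (fun m => 2 * B m) (S M)) E3). }
  rewrite Series_scal_l in L.
  simpl Init.Nat.pred. simpl pos in Ht2.
  assert (0 < eps) by apply cond_pos.
  lra.
Qed.

Lemma sum_f_R0_zero (f : nat -> R) n :
  (forall k, (k <= n)%nat -> f k = 0) -> sum_f_R0 f n = 0.
Proof.
  induction n as [|n IH]; intros H; simpl.
  - apply H; lia.
  - rewrite IH, H; [ring|lia|intros; apply H; lia].
Qed.

Lemma sum_f_R0_trunc (f : nat -> R) n N :
  (n <= N)%nat -> (forall k, (n < k)%nat -> f k = 0) -> sum_f_R0 f N = sum_f_R0 f n.
Proof.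
  intros Hn Hf. induction Hn as [|N HN IH]; [reflexivity|].
  simpl. rewrite IH, Hf; [ring|lia].
Qed.

Lemma sum_f_R0_swap (f : nat -> nat -> R) n m :
  sum_f_R0 (fun i => sum_f_R0 (fun j => f i j) m) n =
  sum_f_R0 (fun j => sum_f_R0 (fun i => f i j) n) m.
Proof.
  induction n as [|n IH]; simpl; [reflexivity|].
  now rewrite IH, sum_plus.
Qed.

Lemma sum_f_R0_scal_l c (f : nat -> R) n :
  sum_f_R0 (fun i => c * f i) n = c * sum_f_R0 f n.
Proof. induction n as [|n IH]; simpl; [ring|]. rewrite IH; ring. Qed.

Lemma sum_f_R0_abs_le (f h : nat -> R) n :
  (forall k, (k <= n)%nat -> Rabs (f k) <= h k) -> Rabs (sum_f_R0 f n) <= sum_f_R0 h n.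
Proof.
  intros H. eapply Rle_trans; [apply Rsum_abs|].
  apply sum_Rle; intros; now apply H.
Qed.

Lemma is_series_finite (a : nat -> R) n :
  (forall k, (n < k)%nat -> a k = 0) -> is_series a (sum_f_R0 a n).
Proof.
  intros H. apply is_series_Reals. intros e He. exists n. intros N HN.
  rewrite (sum_f_R0_trunc a n N) by auto.
  unfold Rdist. rewrite Rminus_diag, Rabs_R0. exact He.
Qed.

(** * Powers and substitution of power series, on coefficients *)

Fixpoint ps_pow (a : nat -> R) (m : nat) : nat -> R :=
  match m with
  | O => fun n => match n with O => 1 | S _ => 0 end
  | S m => PS_mult a (ps_pow a m)
  end.

(* The coefficients of [PSeries g o PSeries a] only when [a 0 = 0], which is what
   allows the sum to stop at [n]. *)
Definition ps_comp (g a : nat -> R) (n : nat) : R :=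
  sum_f_R0 (fun m => g m * ps_pow a m n) n.

Lemma ps_pow_low (a : nat -> R) m n :
  a 0%nat = 0 -> (n < m)%nat -> ps_pow a m n = 0.
Proof.
  intros Ha. revert n. induction m as [|m IH]; intros n Hn; [lia|].
  simpl. unfold PS_mult. apply sum_f_R0_zero. intros [|k] Hk.
  - rewrite Ha; ring.
  - rewrite IH; [ring|lia].
Qed.

Lemma ps_pow_abs (a b : nat -> R) m n :
  (forall l, Rabs (a l) <= b l) -> Rabs (ps_pow a m n) <= ps_pow b m n.
Proof.
  intros H. revert n. induction m as [|m IH]; intros n.
  - destruct n; simpl; rewrite ?Rabs_R1, ?Rabs_R0; lra.
  - simpl. unfold PS_mult. apply sum_f_R0_abs_le. intros k _.
    rewrite Rabs_mult. apply Rmult_le_compat; auto using Rabs_pos.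
Qed.

Lemma ps_pow_pos (a : nat -> R) m n : (forall l, 0 <= a l) -> 0 <= ps_pow a m n.
Proof.
  intros H. eapply Rle_trans; [apply Rabs_pos|].
  apply (ps_pow_abs a a). intros l; rewrite Rabs_pos_eq; auto; lra.
Qed.

Lemma ps_pow_scale (a : nat -> R) q m n :
  ps_pow (fun l => a l * q ^ l) m n = ps_pow a m n * q ^ n.
Proof.
  revert n. induction m as [|m IH]; intros n.
  - destruct n; simpl; ring.
  - simpl. unfold PS_mult. rewrite Rmult_comm, <- sum_f_R0_scal_l.
    apply sum_eq. intros k Hk. rewrite IH.
    replace (q ^ n) with (q ^ k * q ^ (n - k)); [ring|].
    rewrite <- pow_add. f_equal; lia.
Qed.

Lemma is_series_ps_pow_pos (a : nat -> R) m :
  (forall n, 0 <= a n) -> ex_series a -> is_series (ps_pow a m) (Series a ^ m).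
Proof.
  intros Ha E. induction m as [|m IH].
  - change (Series a ^ 0) with (sum_f_R0 (ps_pow a 0) 0).
    apply is_series_finite. intros [|k] Hk; [lia|reflexivity].
  - simpl. apply is_series_mult_pos; auto using Series_correct, ps_pow_pos.
Qed.

(** [is_series_mult] asks for absolute convergence of both factors; for the power it follows from
    the nonnegative case applied to [Rabs (a n)]. *)
Lemma is_series_ps_pow (a : nat -> R) m :
  ex_series (fun n => Rabs (a n)) -> is_series (ps_pow a m) (Series a ^ m).
Proof.
  intros E. induction m as [|m IH].
  - change (Series a ^ 0) with (sum_f_R0 (ps_pow a 0) 0).
    apply is_series_finite. intros [|k] Hk; [lia|reflexivity].
  - simpl. apply is_series_mult; auto using Series_correct, ex_series_Rabs.
    apply ex_series_dom with (ps_pow (fun n => Rabs (a n)) m).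
    + intros n; rewrite Rabs_Rabsolu. apply ps_pow_abs; intros; lra.
    + eexists. apply is_series_ps_pow_pos; auto using Rabs_pos.
Qed.

Lemma is_lim_seq_sum (a : nat -> R) l :
  is_series a l -> is_lim_seq (sum_f_R0 a) l.
Proof.
  intros H. apply is_lim_seq_ext with (sum_n a); [|exact H].
  intros n; apply sum_n_Reals.
Qed.

Lemma sum_le_Series (a : nat -> R) n :
  (forall k, 0 <= a k) -> ex_series a -> sum_f_R0 a n <= Series a.
Proof.
  intros Ha E.
  rewrite (Series_incr_n a (S n)); [|lia|exact E]. simpl Init.Nat.pred.
  assert (0 <= Series (fun k => a (S n + k)%nat)); [|lra].
  rewrite <- (Rmult_0_l (Series (fun _ => 0))), <- Series_scal_l.
  apply Series_le; [intros k; specialize (Ha (S n + k)%nat); lra|].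
  apply (proj1 (ex_series_incr_n a (S n)) E).
Qed.

(** No double series is rearranged: a partial sum in the order of [a] is a finite exchange, and the
    passage to the limit is dominated convergence in [m]. *)
Lemma is_series_ps_comp (g a : nat -> R) :
  a 0%nat = 0 ->
  ex_series (fun n => Rabs (a n)) ->
  ex_series (fun m => Rabs (g m) * Series (fun n => Rabs (a n)) ^ m) ->
  is_series (ps_comp g a) (Series (fun m => g m * Series a ^ m)).
Proof.
  intros Ha Ea Eg.
  set (f := fun (L m : nat) => g m * sum_f_R0 (ps_pow a m) L).
  (* As [ps_pow a m l = 0] for [m > l], the inner sum up to [l] may be extended first to [L], then
     to a full series. *)
  assert (HC : forall L, sum_f_R0 (ps_comp g a) L = Series (f L)).
  { intros L. unfold f.
    rewrite (is_series_unique _ (sum_f_R0 (fun m => g m * sum_f_R0 (ps_pow a m) L) L)).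
    2:{ apply is_series_finite. intros k Hk. rewrite sum_f_R0_zero; [ring|].
        intros l Hl. apply ps_pow_low; [exact Ha|lia]. }
    erewrite (sum_eq _ (fun l => sum_f_R0 (fun m => g m * ps_pow a m l) L)).
    - rewrite sum_f_R0_swap. apply sum_eq; intros m _. now rewrite sum_f_R0_scal_l.
    - intros l Hl. unfold ps_comp. symmetry. apply sum_f_R0_trunc; [exact Hl|].
      intros k Hk. rewrite ps_pow_low by (auto; lia). ring. }
  apply is_series_Reals, is_lim_seq_Reals.
  apply is_lim_seq_ext with (fun L => Series (f L)); [intros; now rewrite HC|].
  unfold is_lim_seq.
  apply (filterlim_Series_dom eventually f _
    (fun m => Rabs (g m) * Series (fun n => Rabs (a n)) ^ m)); [|apply filter_forall|exact Eg].
  - intros m.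
    assert (H := is_lim_seq_sum _ _ (is_series_ps_pow a m Ea)).
    exact (is_lim_seq_scal_l _ (g m) _ H).
  - intros L m. unfold f. rewrite Rabs_mult.
    apply Rmult_le_compat_l; [apply Rabs_pos|].
    eapply Rle_trans.
    + apply sum_f_R0_abs_le. intros k _. apply ps_pow_abs. intros l; apply Rle_refl.
    + assert (P : forall n, 0 <= Rabs (a n)) by (intros; apply Rabs_pos).
      rewrite <- (is_series_unique _ _ (is_series_ps_pow_pos _ m P Ea)).
      apply sum_le_Series; [intros; now apply ps_pow_pos|].
      eexists; apply is_series_ps_pow_pos; auto.
Qed.

Lemma is_pseries_ps_comp (g a : nat -> R) q :
  a 0%nat = 0 ->
  ex_series (fun n => Rabs (a n * q ^ n)) ->
  ex_series (fun m => Rabs (g m) * Series (fun n => Rabs (a n * q ^ n)) ^ m) ->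
  is_pseries (ps_comp g a) q (PSeries g (PSeries a q)).
Proof.
  intros Ha Ea Eg. apply is_pseries_R.
  apply is_series_ext with (ps_comp g (fun n => a n * q ^ n)).
  - intros n. unfold ps_comp. rewrite (Rmult_comm _ (q ^ n)), <- sum_f_R0_scal_l.
    apply sum_eq; intros m _. rewrite ps_pow_scale. ring.
  - apply is_series_ps_comp; auto. rewrite Ha; ring.
Qed.

(** * Uniqueness and Euler operator for power series *)

Lemma CV_radius_ge_ex (a : nat -> R) r :
  ex_series (fun n => a n * r ^ n) -> Rbar_le (Rabs r) (CV_radius a).
Proof.
  intros E. apply Rbar_not_lt_le. intros H.
  apply (CV_disk_outside a r H). now apply ex_series_lim_0.
Qed.

Lemma CV_radius_gt_ex (a : nat -> R) x r :
  Rabs x < r -> ex_series (fun n => a n * r ^ n) -> Rbar_lt (Rabs x) (CV_radius a).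
Proof.
  intros Hx E. apply CV_radius_ge_ex in E.
  apply Rbar_lt_le_trans with (2 := E). simpl.
  pose proof (Rle_abs r). lra.
Qed.

Lemma CV_radius_gt_finite (a : nat -> R) n x :
  (forall k, (n < k)%nat -> a k = 0) -> Rbar_lt (Rabs x) (CV_radius a).
Proof.
  intros H. apply CV_radius_gt_ex with (Rabs x + 1); [lra|].
  eexists. apply (is_series_finite _ n). intros k Hk. rewrite H by exact Hk. ring.
Qed.

Lemma CV_radius_gt_disk (a : nat -> R) (F : R -> R) r x :
  (forall q, Rabs q < r -> is_pseries a q (F q)) -> Rabs x < r ->
  Rbar_lt (Rabs x) (CV_radius a).
Proof.
  intros H Hx. apply CV_radius_gt_ex with ((Rabs x + r) / 2); [lra|].
  eexists. apply is_pseries_R. apply H. rewrite Rabs_pos_eq; [lra|].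
  pose proof (Rabs_pos x); lra.
Qed.

(** The operator [x d/dx], which shifts no index; with [x = exp (- xi)] it is [- d/dxi]. *)
Definition ps_euler (a : nat -> R) (n : nat) : R := INR n * a n.

Lemma ps_euler_incr (a : nat -> R) n : ps_euler a n = PS_incr_1 (PS_derive a) n.
Proof. destruct n; unfold ps_euler; simpl; [apply Rmult_0_l|reflexivity]. Qed.

Lemma CV_radius_euler (a : nat -> R) : CV_radius (ps_euler a) = CV_radius a.
Proof.
  rewrite (CV_radius_ext _ _ (ps_euler_incr a)).
  now rewrite CV_radius_incr_1, CV_radius_derive.
Qed.

Lemma PSeries_euler (a : nat -> R) x :
  PSeries (ps_euler a) x = x * PSeries (PS_derive a) x.
Proof. rewrite (PSeries_ext _ _ x (ps_euler_incr a)). apply PSeries_incr_1. Qed.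

(** Turns a differential identity between closed forms into an identity of coefficients, through the
    uniqueness lemmas below. *)
Lemma is_pseries_euler (a : nat -> R) (F F' : R -> R) r :
  (forall q, Rabs q < r -> is_pseries a q (F q)) ->
  (forall q, Rabs q < r -> is_derive F q (F' q)) ->
  forall q, Rabs q < r -> is_pseries (ps_euler a) q (q * F' q).
Proof.
  intros Ha HF q Hq.
  assert (HR := CV_radius_gt_disk a F r q Ha Hq).
  replace (q * F' q) with (PSeries (ps_euler a) q).
  - apply PSeries_correct, CV_radius_inside. now rewrite CV_radius_euler.
  - rewrite PSeries_euler. f_equal.
    rewrite <- (is_derive_unique _ _ _ (is_derive_PSeries a q HR)).
    apply is_derive_unique.
    apply is_derive_ext_loc with (2 := HF q Hq).
    assert (Hr : 0 < r - Rabs q) by lra.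
    exists (mkposreal _ Hr). intros y Hy.
    symmetry. apply is_pseries_unique, Ha.
    change (Rabs (y - q) < r - Rabs q) in Hy.
    replace y with ((y - q) + q) by ring.
    pose proof (Rabs_triang (y - q) q). lra.
Qed.

(** Vanishing is assumed for positive [q] only, because the expansion of [ubar] gives information
    only at [q = exp (- xi)]. *)
Lemma PSeries_zero_right_0 (a : nat -> R) r :
  0 < r -> Rbar_lt 0 (CV_radius a) -> (forall q, 0 < q < r -> PSeries a q = 0) ->
  a 0%nat = 0.
Proof.
  intros Hr HR H. destruct (Req_dec (a 0%nat) 0) as [|N]; [assumption|exfalso].
  assert (C : continuity_pt (PSeries a) 0).
  { apply PSeries_continuity. now rewrite Rabs_R0. }
  destruct (C (Rabs (a 0%nat))) as [d [Hd HC]]; [now apply Rabs_pos_lt|].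
  set (x := Rmin d r / 2).
  assert (Hm : 0 < Rmin d r) by (apply Rmin_glb_lt; lra).
  assert (Hx : 0 < x < r /\ x < d).
  { unfold x. pose proof (Rmin_l d r). pose proof (Rmin_r d r). lra. }
  specialize (HC x). simpl in HC. unfold Rdist in HC.
  rewrite H, PSeries_0, Rminus_0_l, Rabs_Ropp in HC by lra.
  apply (Rlt_irrefl (Rabs (a 0%nat))). apply HC. split.
  - split; [exact I|lra].
  - rewrite Rabs_pos_eq; lra.
Qed.

Lemma PSeries_zero_right (a : nat -> R) r :
  0 < r -> Rbar_lt 0 (CV_radius a) -> (forall q, 0 < q < r -> PSeries a q = 0) ->
  forall n, a n = 0.
Proof.
  intros Hr HR H n. revert a HR H. induction n as [|n IH]; intros a HR H.
  - now apply PSeries_zero_right_0 with r.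
  - assert (H0 := PSeries_zero_right_0 a r Hr HR H).
    apply (IH (PS_decr_1 a)).
    + now rewrite CV_radius_decr_1.
    + intros q Hq. specialize (H q Hq). rewrite PSeries_decr_1_aux in H by exact H0.
      apply Rmult_integral in H. destruct H; [lra|assumption].
Qed.

Lemma pseries_unique_right (a b : nat -> R) (F : R -> R) r :
  0 < r ->
  (forall q, 0 < q < r -> is_pseries a q (F q)) ->
  (forall q, 0 < q < r -> is_pseries b q (F q)) ->
  forall n, a n = b n.
Proof.
  intros Hr Ha Hb n.
  assert (Hab : forall q, 0 < q < r -> is_pseries (PS_minus a b) q 0).
  { intros q Hq. replace 0 with (F q - F q) by ring.
    exact (is_pseries_minus a b q _ _ (Ha q Hq) (Hb q Hq)). }
  assert (E : PS_minus a b n = 0).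
  { apply (PSeries_zero_right _ r Hr).
    - rewrite <- Rabs_R0. apply CV_radius_gt_ex with (r / 2); [rewrite Rabs_R0; lra|].
      exists 0. apply is_pseries_R, Hab. lra.
    - intros q Hq. now apply is_pseries_unique, Hab. }
  change (a n + - b n = 0) in E. lra.
Qed.

Lemma pseries_unique_disk (a b : nat -> R) (F : R -> R) r :
  0 < r ->
  (forall q, Rabs q < r -> is_pseries a q (F q)) ->
  (forall q, Rabs q < r -> is_pseries b q (F q)) ->
  forall n, a n = b n.
Proof.
  intros Hr Ha Hb. apply (pseries_unique_right a b F r Hr);
    intros q Hq; [apply Ha|apply Hb]; rewrite Rabs_pos_eq; lra.
Qed.

(** * The explicit sinh-Gordon solution *)

Definition odd_ind (n : nat) : R := if Nat.odd n then 1 else 0.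

Lemma pow_neg_odd_ind x n : (- x) ^ n = (1 - 2 * odd_ind n) * x ^ n.
Proof.
  unfold odd_ind. induction n as [|n IH]; [simpl; ring|].
  rewrite Nat.odd_succ, <- Nat.negb_odd. simpl pow. rewrite IH.
  destruct (Nat.odd n); simpl; ring.
Qed.

Lemma one_minus_sqr_pos y : Rabs y < 1 -> 0 < 1 - y ^ 2.
Proof. intros H. apply Rabs_def2 in H. nra. Qed.

Lemma is_pseries_odd_ind y : Rabs y < 1 -> is_pseries odd_ind y (y / (1 - y ^ 2)).
Proof.
  intros Hy. apply is_pseries_R.
  assert (H1 := is_series_geom y Hy).
  assert (Hy' : Rabs (- y) < 1) by now rewrite Rabs_Ropp.
  assert (H2 := is_series_geom (- y) Hy').
  assert (H := is_series_scal_r (/ 2) _ _ (is_series_minus _ _ _ _ H1 H2)).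
  apply Rabs_def2 in Hy.
  replace (y / (1 - y ^ 2)) with (plus (/ (1 - y)) (opp (/ (1 - - y))) * / 2).
  - apply is_series_ext with (2 := H). intros n.
    change (plus (y ^ n) (opp ((- y) ^ n)) * / 2 = odd_ind n * y ^ n).
    change (plus (y ^ n) (opp ((- y) ^ n))) with (y ^ n + - (- y) ^ n).
    rewrite pow_neg_odd_ind. field.
  - change (plus (/ (1 - y)) (opp (/ (1 - - y)))) with (/ (1 - y) + - / (1 - - y)).
    field. repeat split; nra.
Qed.

(** At [k = 0] the division by [INR 0] does no harm, since [odd_ind 0 = 0]. *)
Definition phi (alpha : R) (k : nat) : R := 4 / alpha * (odd_ind k / INR k).

Lemma euler_phi alpha k : ps_euler (phi alpha) k = 4 / alpha * odd_ind k.
Proof.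
  unfold ps_euler, phi. destruct k; [unfold odd_ind; simpl; ring|].
  replace (INR (S k) * (4 / alpha * (odd_ind (S k) / INR (S k))))
    with (4 / alpha * (odd_ind (S k) * (INR (S k) * / INR (S k)))) by (unfold Rdiv; ring).
  rewrite Rinv_r by (apply not_0_INR; lia). ring.
Qed.

Lemma odd_ind_pos n : 0 <= odd_ind n.
Proof. unfold odd_ind; destruct (Nat.odd n); lra. Qed.

Lemma phi_pos alpha k : 0 < alpha -> 0 <= phi alpha k.
Proof.
  intros Ha. unfold phi. apply Rmult_le_pos.
  - apply Rlt_le, Rdiv_lt_0_compat; lra.
  - destruct k; [unfold odd_ind; simpl; lra|].
    apply Rdiv_le_0_compat; [apply odd_ind_pos|apply lt_0_INR; lia].
Qed.

Lemma CV_radius_phi alpha y : Rabs y < 1 -> alpha <> 0 -> Rbar_lt (Rabs y) (CV_radius (phi alpha)).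
Proof.
  intros Hy Ha. rewrite <- CV_radius_euler.
  rewrite (CV_radius_ext _ (PS_scal (4 / alpha) odd_ind)).
  - rewrite CV_radius_scal.
    + exact (CV_radius_gt_disk odd_ind _ 1 y is_pseries_odd_ind Hy).
    + unfold Rdiv. apply Rmult_integral_contrapositive. split; [lra|now apply Rinv_neq_0_compat].
  - apply euler_phi.
Qed.

Lemma derive_phi alpha n : PS_derive (phi alpha) n = 4 / alpha * odd_ind (S n).
Proof. rewrite <- euler_phi. reflexivity. Qed.

Lemma PSeries_derive_phi alpha y :
  Rabs y < 1 -> PSeries (PS_derive (phi alpha)) y = 4 / alpha / (1 - y ^ 2).
Proof.
  intros Hy.
  (* The Euler identity yields the claim multiplied by [y], so [y = 0] is read off the constant
     coefficient. *)
  destruct (Req_dec y 0) as [->|Hy0].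
  - rewrite PSeries_0, derive_phi. unfold odd_ind; simpl.
    rewrite Rmult_0_l, Rminus_0_r. unfold Rdiv. now rewrite Rinv_1.
  - apply Rmult_eq_reg_l with y; [|exact Hy0].
    rewrite <- PSeries_euler, (PSeries_ext _ (PS_scal (4 / alpha) odd_ind)).
    + rewrite PSeries_scal, (is_pseries_unique _ _ _ (is_pseries_odd_ind y Hy)).
      unfold Rdiv; ring.
    + apply euler_phi.
Qed.

(** Both sides vanish at 0 and have the derivative [4 / alpha / (1 - y ^ 2)]. *)
Lemma PSeries_phi alpha y :
  alpha <> 0 -> Rabs y < 1 -> PSeries (phi alpha) y = 2 / alpha * (ln (1 + y) - ln (1 - y)).
Proof.
  intros Ha Hy.
  set (h := fun t => PSeries (phi alpha) t - 2 / alpha * (ln (1 + t) - ln (1 - t))).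
  assert (Hd : forall t, Rabs t < 1 -> is_derive h t 0).
  { intros t Ht.
    assert (D1 := is_derive_PSeries _ _ (CV_radius_phi alpha t Ht Ha)).
    rewrite PSeries_derive_phi in D1 by exact Ht.
    assert (D2 : is_derive (fun t => 2 / alpha * (ln (1 + t) - ln (1 - t))) t
                  (4 / alpha / (1 - t ^ 2))).
    { pose proof (one_minus_sqr_pos t Ht). apply Rabs_def2 in Ht.
      auto_derive; [repeat split; lra|]. field. repeat split; try lra; nra. }
    replace 0 with (minus (4 / alpha / (1 - t ^ 2)) (4 / alpha / (1 - t ^ 2))).
    - exact (is_derive_minus _ _ _ _ _ D1 D2).
    - apply Rminus_diag. }
  assert (B : forall t, Rmin 0 y <= t <= Rmax 0 y -> Rabs t < 1).
  { intros t Ht. apply Rabs_def2 in Hy. unfold Rmin, Rmax in Ht.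
    apply Rabs_def1; destruct (Rle_dec 0 y); lra. }
  destruct (MVT_gen h 0 y (fun _ => 0)) as [c [_ Hc]].
  - intros t Ht. apply Hd, B; lra.
  - intros t Ht. apply derivable_continuous_pt.
    exists 0. apply is_derive_Reals. apply Hd, B; lra.
  - unfold h in Hc. rewrite PSeries_0 in Hc. unfold phi at 2 in Hc.
    unfold odd_ind in Hc. simpl in Hc.
    rewrite Rplus_0_r, Rminus_0_r, ln_1 in Hc. lra.
Qed.

Definition sinh_coef (alpha : R) (m : nat) : R :=
  odd_ind m * (alpha ^ (m - 1) / INR (fact m)).

Lemma is_pseries_sinh_coef alpha u :
  alpha <> 0 -> is_pseries (sinh_coef alpha) u (sinh (alpha * u) / alpha).
Proof.
  intros Ha. apply is_pseries_R.
  assert (H1 := proj1 (is_pseries_R _ _ _) (is_exp_Reals (alpha * u))).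
  assert (H2 := proj1 (is_pseries_R _ _ _) (is_exp_Reals (- (alpha * u)))).
  assert (H := is_series_scal_r (/ (2 * alpha)) _ _ (is_series_minus _ _ _ _ H1 H2)).
  replace (sinh (alpha * u) / alpha)
    with (plus (exp (alpha * u)) (opp (exp (- (alpha * u)))) * / (2 * alpha)).
  - apply is_series_ext with (2 := H). intros n.
    change ((/ INR (fact n) * (alpha * u) ^ n - / INR (fact n) * (- (alpha * u)) ^ n)
       * / (2 * alpha) = sinh_coef alpha n * u ^ n).
    rewrite pow_neg_odd_ind, Rpow_mult_distr. unfold sinh_coef.
    pose proof (INR_fact_neq_0 n).
    destruct n; [unfold odd_ind; simpl; field; exact Ha|].
    replace (S n - 1)%nat with n by lia. 
    rewrite <- (tech_pow_Rmult alpha). field. split; assumption.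
  - change (plus (exp (alpha * u)) (opp (exp (- (alpha * u)))))
      with (exp (alpha * u) - exp (- (alpha * u))).
    unfold sinh. field. exact Ha.
Qed.

Lemma phi_0 alpha : phi alpha 0%nat = 0.
Proof. unfold phi, odd_ind. simpl. unfold Rdiv. ring. Qed.

Lemma entire_ex_series (g : nat -> R) V :
  (forall x, ex_pseries g x) -> 0 <= V -> ex_series (fun m => Rabs (g m) * V ^ m).
Proof.
  intros H HV. apply ex_series_ext with (fun m => Rabs (g m * V ^ m)).
  - intros m. now rewrite Rabs_mult, (Rabs_pos_eq (V ^ m)) by now apply pow_le.
  - apply CV_disk_inside. apply CV_radius_gt_ex with (Rabs V + 1); [lra|].
    apply ex_pseries_R, H.
Qed.

(* [F y = 2 / alpha * ln ((1 + y) / (1 - y))] satisfies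
   [sinh (alpha F) / alpha = (y d/dy)^2 F]. *)
Lemma ps_comp_sinh_phi alpha k :
  0 < alpha -> ps_comp (sinh_coef alpha) (phi alpha) k = INR k ^ 2 * phi alpha k.
Proof.
  intros Ha.
  replace (INR k ^ 2 * phi alpha k) with (ps_euler (ps_euler (phi alpha)) k)
    by (unfold ps_euler; ring).
  revert k.
  (* The closed form of [(y d/dy)^2] applied to the logarithm. *)
  apply (pseries_unique_disk _ _ (fun y => y * (4 / alpha * (1 + y ^ 2) / (1 - y ^ 2) ^ 2)) 1 Rlt_0_1).
  - intros y Hy.
    replace (y * (4 / alpha * (1 + y ^ 2) / (1 - y ^ 2) ^ 2))
      with (PSeries (sinh_coef alpha) (PSeries (phi alpha) y)).
    + apply is_pseries_ps_comp.
      * apply phi_0.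
      * apply CV_disk_inside, CV_radius_phi; lra.
      * apply entire_ex_series.
        -- intros x. eexists. apply is_pseries_sinh_coef; lra.
        -- eapply Rle_trans; [apply Rabs_pos|]. apply (Series_Rabs (fun n => phi alpha n * y ^ n)).
           apply CV_disk_inside, CV_radius_phi; lra.
    + rewrite (is_pseries_unique _ _ _ (is_pseries_sinh_coef alpha _ ltac:(lra))).
      rewrite PSeries_phi by (assumption || lra).
      (* Sums of logarithms, so that [exp_plus] and [exp_ln] make the [sinh] a rational function of
         [y]. *)
      replace (alpha * (2 / alpha * (ln (1 + y) - ln (1 - y))))
        with ((ln (1 + y) + ln (1 + y)) + - (ln (1 - y) + ln (1 - y))) by (field; lra).
      pose proof (one_minus_sqr_pos y Hy). apply Rabs_def2 in Hy.
      unfold sinh.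
      replace (- (ln (1 + y) + ln (1 + y) + - (ln (1 - y) + ln (1 - y))))
        with (- (ln (1 + y) + ln (1 + y)) + (ln (1 - y) + ln (1 - y))) by ring.
      rewrite !exp_plus, !exp_Ropp, !exp_plus, !exp_ln by lra.
      field. repeat split; nra.
  - apply (is_pseries_euler _ (fun y => y * (4 / alpha / (1 - y ^ 2)))).
    + apply (is_pseries_euler _ (PSeries (phi alpha)) (fun y => 4 / alpha / (1 - y ^ 2))).
      * intros q Hq. apply PSeries_correct, CV_radius_inside, CV_radius_phi; lra.
      * intros q Hq. rewrite <- PSeries_derive_phi by exact Hq.
        apply is_derive_PSeries, CV_radius_phi; lra.
    + intros q Hq. pose proof (one_minus_sqr_pos q Hq). auto_derive; [simpl in *; lra|].
      field. repeat split; simpl in *; nra.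
Qed.

(* [wfun b (exp (- xi)) = b / sinh xi]. *)
Definition wfun (b q : R) : R := 2 * b * (q / (1 - q ^ 2)).
Definition wcoef (b : R) (l : nat) : R := 2 * b * odd_ind l.

Lemma is_pseries_wcoef b q : Rabs q < 1 -> is_pseries (wcoef b) q (wfun b q).
Proof. intros Hq. exact (is_pseries_scal (2 * b) _ _ _ (Rmult_comm _ _) (is_pseries_odd_ind q Hq)). Qed.

Lemma ex_series_wcoef b q : Rabs q < 1 -> ex_series (fun n => Rabs (wcoef b n * q ^ n)).
Proof.
  intros Hq. apply CV_disk_inside.
  exact (CV_radius_gt_disk _ _ 1 q (is_pseries_wcoef b) Hq).
Qed.

Lemma is_pseries_wpow b k q :
  Rabs q < 1 -> is_pseries (ps_pow (wcoef b) k) q (wfun b q ^ k).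
Proof.
  intros Hq. apply is_pseries_R.
  rewrite <- (is_pseries_unique _ _ _ (is_pseries_wcoef b q Hq)).
  apply is_series_ext with (ps_pow (fun n => wcoef b n * q ^ n) k).
  - intros n. apply ps_pow_scale.
  - apply is_series_ps_pow, ex_series_wcoef, Hq.
Qed.

(** Obtained from the functions by uniqueness, which spares a proof that the Cauchy product is
    associative. *)
Lemma PS_mult_wpow b i j l :
  PS_mult (ps_pow (wcoef b) i) (ps_pow (wcoef b) j) l = ps_pow (wcoef b) (i + j) l.
Proof.
  revert l. apply (pseries_unique_disk _ _ (fun q => wfun b q ^ (i + j)) 1 Rlt_0_1).
  - intros q Hq. rewrite pow_add.
    apply is_pseries_mult; try apply is_pseries_wpow; try exact Hq;
      refine (CV_radius_gt_disk _ _ 1 q (is_pseries_wpow b _) Hq).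
  - intros q Hq. now apply is_pseries_wpow.
Qed.

(* With [w = wfun b]: [(q w')^2 = w^2 (1 + w^2 / b^2)], which turns
   [(q d/dq)^2 (w^k)] into [k^2 w^k + k (k + 1) / b^2 w^(k + 2)]. *)
Lemma wpow_rec b k l : 0 < b -> (1 <= k)%nat ->
  b ^ 2 * (INR l ^ 2 - INR k ^ 2) * ps_pow (wcoef b) k l =
  INR k * (INR k + 1) * ps_pow (wcoef b) (k + 2) l.
Proof.
  intros Hb Hk.
  set (W := ps_pow (wcoef b)).
  cut (ps_euler (ps_euler (W k)) l =
     PS_plus (PS_scal (INR k ^ 2) (W k)) (PS_scal (INR k * (INR k + 1) / b ^ 2) (W (k + 2)%nat)) l).
  { unfold ps_euler. intros E.
    change (INR l * (INR l * W k l) =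
      INR k ^ 2 * W k l + INR k * (INR k + 1) / b ^ 2 * W (k + 2)%nat l) in E.
    replace (b ^ 2 * (INR l ^ 2 - INR k ^ 2) * W k l)
      with (b ^ 2 * (INR l * (INR l * W k l) - INR k ^ 2 * W k l)) by ring.
    rewrite E. field. lra. }
  revert l.
  apply (pseries_unique_disk _ _ (fun q => INR k ^ 2 * wfun b q ^ k +
     INR k * (INR k + 1) / b ^ 2 * wfun b q ^ (k + 2)) 1 Rlt_0_1).
  - intros q Hq.
    (* [s] is [coth xi] for [q = exp (- xi)]: one has [q w' = w s] and
       [s ^ 2 = 1 + w ^ 2 / b ^ 2]. *)
    set (s := fun q : R => (1 + q ^ 2) / (1 - q ^ 2)).
    set (w' := fun q : R => 2 * b * ((1 + q ^ 2) / (1 - q ^ 2) ^ 2)).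
    set (s' := fun q : R => 4 * q / (1 - q ^ 2) ^ 2).
    assert (Dw : forall q, Rabs q < 1 -> is_derive (wfun b) q (w' q)).
    { intros x Hx. pose proof (one_minus_sqr_pos x Hx). unfold wfun, w'.
      auto_derive; [simpl in *; lra|]. field. simpl in *; nra. }
    assert (Ds : forall q, Rabs q < 1 -> is_derive s q (s' q)).
    { intros x Hx. pose proof (one_minus_sqr_pos x Hx). unfold s, s'.
      auto_derive; [simpl in *; lra|]. field. simpl in *; nra. }
    assert (P1 : forall q, Rabs q < 1 ->
       is_pseries (ps_euler (W k)) q (INR k * (wfun b q ^ k * s q))).
    { intros x Hx.
      replace (INR k * (wfun b x ^ k * s x))
        with (x * (INR k * w' x * wfun b x ^ Nat.pred k)).
      - apply (is_pseries_euler _ (fun q => wfun b q ^ k)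
          (fun x => INR k * w' x * wfun b x ^ Nat.pred k) 1); [| |exact Hx].
        + intros y Hy. now apply is_pseries_wpow.
        + intros y Hy. apply is_derive_pow. now apply Dw.
      - destruct k as [|j]; [lia|]. simpl Nat.pred. simpl (wfun b x ^ S j).
        pose proof (one_minus_sqr_pos x Hx).
        unfold w', s. unfold wfun at 2. field. simpl in *; nra. }
    replace (INR k ^ 2 * wfun b q ^ k + INR k * (INR k + 1) / b ^ 2 * wfun b q ^ (k + 2))
      with (q * (INR k * (INR k * w' q * wfun b q ^ Nat.pred k * s q + wfun b q ^ k * s' q))).
    + apply (is_pseries_euler _ _ (fun q => INR k * (INR k * w' q * wfun b q ^ Nat.pred k * s q + wfun b q ^ k * s' q)) 1 P1); [|exact Hq].
      intros x Hx. apply is_derive_scal.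
      apply (is_derive_mult (fun x => wfun b x ^ k) s).
      * apply is_derive_pow. now apply Dw.
      * now apply Ds.
      * intros; apply Rmult_comm.
    + destruct k as [|j]; [lia|]. simpl Nat.pred.
      replace (S j + 2)%nat with (S (S (S j))) by lia. simpl (wfun b q ^ S _).
      pose proof (one_minus_sqr_pos q Hq).
      set (J := INR (S j)). set (X := wfun b q ^ j).
      unfold w', s, s', wfun. field. split; simpl in *; nra.
  - intros q Hq.
    apply (is_pseries_plus (PS_scal (INR k ^ 2) (W k)) _ q (INR k ^ 2 * wfun b q ^ k)
      (INR k * (INR k + 1) / b ^ 2 * wfun b q ^ (k + 2)));
    apply (is_pseries_scal (K:=R_AbsRing) (V:=R_NormedModule)); try apply Rmult_comm; now apply is_pseries_wpow.
Qed.

(** * The coefficient recursion *)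

(* An array [A] stands for the double series [sum_{l,k} A l k * q ^ l * c ^ k]. *)
Fixpoint pow2 (A : nat -> nat -> R) (m : nat) : nat -> nat -> R :=
  match m with
  | O => fun l k => match l, k with O, O => 1 | _, _ => 0 end
  | S m => fun l k => sum_f_R0 (fun j => PS_mult (A j) (pow2 A m (l - j)) k) l
  end.

(** Stopping at [m = l] loses nothing when row 0 of [A] vanishes, by [pow2_low]. *)
Definition comp2 (g : nat -> R) (A : nat -> nat -> R) (l k : nat) : R :=
  sum_f_R0 (fun m => g m * pow2 A m l k) l.

Lemma pow2_abs (A P : nat -> nat -> R) m l k :
  (forall l k, Rabs (A l k) <= P l k) -> Rabs (pow2 A m l k) <= pow2 P m l k.
Proof.
  intros H. revert l k. induction m as [|m IH]; intros l k.
  - destruct l; [destruct k|]; simpl; rewrite ?Rabs_R1, ?Rabs_R0; lra.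
  - simpl. apply sum_f_R0_abs_le. intros j _. apply sum_f_R0_abs_le. intros i _.
    rewrite Rabs_mult. apply Rmult_le_compat; auto using Rabs_pos.
Qed.

Lemma comp2_abs (g h : nat -> R) (A P : nat -> nat -> R) l k :
  (forall m, Rabs (g m) <= h m) -> (forall l k, Rabs (A l k) <= P l k) ->
  Rabs (comp2 g A l k) <= comp2 h P l k.
Proof.
  intros Hg HA. apply sum_f_R0_abs_le. intros m _. rewrite Rabs_mult.
  apply Rmult_le_compat; auto using Rabs_pos, pow2_abs.
Qed.

Lemma pow2_support (A : nat -> nat -> R) m l k :
  (forall l k, (l < k)%nat -> A l k = 0) -> (l < k)%nat -> pow2 A m l k = 0.
Proof.
  intros H. revert l k. induction m as [|m IH]; intros l k Hk.
  - destruct l; [destruct k|]; simpl; trivial; lia.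
  - simpl. apply sum_f_R0_zero. intros j Hj. apply sum_f_R0_zero. intros i Hi.
    destruct (Nat.le_gt_cases i j).
    + rewrite IH; [ring|lia].
    + rewrite H; [ring|lia].
Qed.

Lemma comp2_support (g : nat -> R) (A : nat -> nat -> R) l k :
  (forall l k, (l < k)%nat -> A l k = 0) -> (l < k)%nat -> comp2 g A l k = 0.
Proof.
  intros H Hk. apply sum_f_R0_zero. intros m _. rewrite pow2_support; auto; ring.
Qed.

Lemma pow2_low (A : nat -> nat -> R) m l k :
  (forall k, A 0%nat k = 0) -> (l < m)%nat -> pow2 A m l k = 0.
Proof.
  intros H. revert l k. induction m as [|m IH]; intros l k Hl; [lia|].
  simpl. apply sum_f_R0_zero. intros [|j] Hj; apply sum_f_R0_zero; intros i Hi.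
  - rewrite H; ring.
  - rewrite IH; [ring|lia].
Qed.

Lemma pow2_eq_upto (A B : nat -> nat -> R) m l k :
  (forall j k, (j <= l)%nat -> A j k = B j k) -> pow2 A m l k = pow2 B m l k.
Proof.
  revert l k. induction m as [|m IH]; intros l k H; [reflexivity|].
  simpl. apply sum_eq. intros j Hj. apply sum_eq. intros i Hi.
  rewrite H, IH; [reflexivity| |exact Hj]. intros; apply H; lia.
Qed.

(** In a product of at least two factors without order 0, no factor reaches order [l]. Hence the
    nonlinear term at order [l] depends on lower orders alone, which is what makes the recursion
    solvable. *)
Lemma pow2_eq_below (A B : nat -> nat -> R) m l k :
  (forall k, A 0%nat k = 0) -> (forall k, B 0%nat k = 0) ->
  (forall j k, (j < l)%nat -> A j k = B j k) -> (2 <= m)%nat ->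
  pow2 A m l k = pow2 B m l k.
Proof.
  intros HA HB H Hm. destruct m as [|[|m]]; try lia.
  change (sum_f_R0 (fun j => PS_mult (A j) (pow2 A (S m) (l - j)) k) l =
          sum_f_R0 (fun j => PS_mult (B j) (pow2 B (S m) (l - j)) k) l).
  apply sum_eq. intros j Hj. apply sum_eq. intros i Hi.
  destruct (Nat.eq_dec j 0) as [->|Hj0]; [rewrite HA, HB; ring|].
  destruct (Nat.eq_dec j l) as [->|Hjl].
  - rewrite !pow2_low by (auto; lia). ring.
  - rewrite H by lia. rewrite (pow2_eq_upto A B); [reflexivity|].
    intros; apply H; lia.
Qed.

Lemma comp2_eq_below (g : nat -> R) (A B : nat -> nat -> R) l k :
  g 0%nat = 0 -> g 1%nat = 0 ->
  (forall k, A 0%nat k = 0) -> (forall k, B 0%nat k = 0) ->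
  (forall j k, (j < l)%nat -> A j k = B j k) -> comp2 g A l k = comp2 g B l k.
Proof.
  intros H0 H1 HA HB H. apply sum_eq. intros [|[|m]] _.
  - rewrite H0; ring.
  - rewrite H1; ring.
  - f_equal. apply pow2_eq_below; auto; lia.
Qed.

Lemma is_pseries_sum (f : nat -> nat -> R) (s : nat -> R) c n :
  (forall j, (j <= n)%nat -> is_pseries (f j) c (s j)) ->
  is_pseries (fun k => sum_f_R0 (fun j => f j k) n) c (sum_f_R0 s n).
Proof.
  induction n as [|n IH]; intros H; simpl; [now apply H|].
  apply (is_pseries_plus (fun k => sum_f_R0 (fun j => f j k) n) (f (S n))).
  - apply IH. intros; apply H; lia.
  - apply H; lia.
Qed.

Lemma is_pseries_finite (a : nat -> R) n c :
  (forall k, (n < k)%nat -> a k = 0) -> is_pseries a c (PSeries a c).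
Proof.
  intros H. apply PSeries_correct, CV_radius_inside.
  now apply CV_radius_gt_finite with n.
Qed.

(** Rows are polynomials in [c], so evaluation commutes with products for every real [c]. *)
Lemma ps_pow_eval (A : nat -> nat -> R) c m l :
  (forall l k, (l < k)%nat -> A l k = 0) ->
  ps_pow (fun l => PSeries (A l) c) m l = PSeries (pow2 A m l) c.
Proof.
  intros H. revert l. induction m as [|m IH]; intros l.
  - symmetry. apply is_pseries_unique. destruct l.
    + replace (ps_pow (fun l => PSeries (A l) c) 0 0) with
        (sum_f_R0 (fun k => pow2 A 0 0 k * c ^ k) 0) by (simpl; ring).
      apply is_pseries_R, is_series_finite. intros [|k] Hk; [lia|simpl; ring].
    + replace (ps_pow (fun l => PSeries (A l) c) 0 (S l)) with
        (sum_f_R0 (fun k => pow2 A 0 (S l) k * c ^ k) 0) by (simpl; ring).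
      apply is_pseries_R, is_series_finite. intros k Hk; simpl; ring.
  - symmetry. apply is_pseries_unique. simpl. apply is_pseries_sum.
    intros j Hj. rewrite IH.
    apply is_pseries_mult.
    + now apply is_pseries_finite with j; auto.
    + apply is_pseries_finite with (l - j)%nat. intros; now apply pow2_support.
    + apply CV_radius_gt_finite with j; auto.
    + apply CV_radius_gt_finite with (l - j)%nat. intros; now apply pow2_support.
Qed.

Lemma ps_comp_eval (g : nat -> R) (A : nat -> nat -> R) c l :
  (forall l k, (l < k)%nat -> A l k = 0) ->
  ps_comp g (fun l => PSeries (A l) c) l = PSeries (comp2 g A l) c.
Proof.
  intros H. symmetry. apply is_pseries_unique. apply is_pseries_sum.
  intros m Hm. rewrite ps_pow_eval by exact H.
  apply (is_pseries_scal (g m) (pow2 A m l) c _ (Rmult_comm _ _)).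
  apply is_pseries_finite with l. intros; now apply pow2_support.
Qed.

(** The linear term of the equation is accounted for by the [- 1] in [mu]; only degrees from 2 on
    form the nonlinear term. *)
Definition trunc2 (g : nat -> R) (m : nat) : R :=
  match m with O => 0 | S O => 0 | _ => g m end.

Lemma sum_trunc2 (g x : nat -> R) n :
  sum_f_R0 (fun m => g m * x m) (S n) =
  sum_f_R0 (fun m => trunc2 g m * x m) (S n) + g 0%nat * x 0%nat + g 1%nat * x 1%nat.
Proof.
  induction n as [|n IH]; [simpl; ring|].
  rewrite (tech5 _ (S n)), IH, (tech5 _ (S n)). simpl (trunc2 g (S (S n))). ring.
Qed.

(* Coefficient of [c ^ k * q ^ l] in the sinh-Gordon solution, which is the
   composition of [phi] with [c * wfun b q]. *)
Definition Pcoef (alpha b : R) (l k : nat) : R := phi alpha k * ps_pow (wcoef b) k l.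

Lemma wcoef_pos b l : 0 < b -> 0 <= wcoef b l.
Proof.
  intros Hb. unfold wcoef. apply Rmult_le_pos; [lra|apply odd_ind_pos].
Qed.

Lemma wcoef_0 b : wcoef b 0 = 0.
Proof. unfold wcoef, odd_ind; simpl; ring. Qed.

Lemma Pcoef_pos alpha b l k : 0 < alpha -> 0 < b -> 0 <= Pcoef alpha b l k.
Proof.
  intros Ha Hb. apply Rmult_le_pos; [now apply phi_pos|].
  apply ps_pow_pos. intros; now apply wcoef_pos.
Qed.

Lemma Pcoef_support alpha b l k : (l < k)%nat -> Pcoef alpha b l k = 0.
Proof.
  intros H. unfold Pcoef. rewrite ps_pow_low; [ring|apply wcoef_0|exact H].
Qed.

Lemma Pcoef_even alpha b l k : Nat.odd k = false -> Pcoef alpha b l k = 0.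
Proof.
  intros H. unfold Pcoef, phi, odd_ind. rewrite H. unfold Rdiv; ring.
Qed.

Lemma Pcoef_l0 alpha b k : Pcoef alpha b 0 k = 0.
Proof.
  destruct k; [now apply Pcoef_even|apply Pcoef_support; lia].
Qed.

Lemma ps_pow_1 (a : nat -> R) n : ps_pow a 1 n = a n.
Proof.
  change (sum_f_R0 (fun k => a k * ps_pow a 0 (n - k)) n = a n).
  destruct n as [|n]; [simpl; ring|]. rewrite tech5, sum_f_R0_zero.
  - rewrite Nat.sub_diag; simpl; ring.
  - intros k Hk. replace (S n - k)%nat with (S (n - k)) by lia. simpl; ring.
Qed.

(** Powers of [phi (c w)] are again functions of [c w]: the coefficient of [c ^ k] always carries
    exactly [w ^ k], because [w ^ i * w ^ (k - i) = w ^ k]. *)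
Lemma pow2_Pcoef alpha b m l k :
  pow2 (Pcoef alpha b) m l k = ps_pow (phi alpha) m k * ps_pow (wcoef b) k l.
Proof.
  revert l k. induction m as [|m IH]; intros l k.
  - destruct k; [destruct l; simpl; ring|]. simpl (ps_pow (phi alpha) 0 (S k)).
    rewrite Rmult_0_l. now destruct l.
  - simpl pow2. unfold PS_mult at 1.
    rewrite sum_f_R0_swap. simpl ps_pow at 1. unfold PS_mult at 1.
    rewrite Rmult_comm, <- sum_f_R0_scal_l. apply sum_eq. intros i Hi.
    replace (ps_pow (wcoef b) k) with (ps_pow (wcoef b) (i + (k - i))) by (f_equal; lia).
    rewrite <- PS_mult_wpow. unfold PS_mult.
    rewrite Rmult_comm, <- sum_f_R0_scal_l.
    apply sum_eq. intros j Hj. rewrite IH. unfold Pcoef. ring.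
Qed.

(** By [ps_comp_sinh_phi] the full sinh term multiplies the coefficient by [k ^ 2]; the [- 1] is the
    linear term removed by [trunc2]. *)
Lemma comp2_sinh_Pcoef alpha b l k : 0 < alpha ->
  comp2 (trunc2 (sinh_coef alpha)) (Pcoef alpha b) l k =
  (INR k ^ 2 - 1) * Pcoef alpha b l k.
Proof.
  (* [sum_trunc2] separates degrees 0 and 1, so it needs a sum reaching at least 1. *)
  intros Ha. destruct l as [|l].
  { rewrite Pcoef_l0. unfold comp2. simpl. ring. }
  destruct (Nat.lt_ge_cases (S l) k) as [Hk|Hk].
  { rewrite comp2_support, Pcoef_support; auto; [ring|].
    intros; now apply Pcoef_support. }
  assert (E : sum_f_R0 (fun m => sinh_coef alpha m * ps_pow (phi alpha) m k) (S l)
     = INR k ^ 2 * phi alpha k).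
  { rewrite <- ps_comp_sinh_phi by exact Ha. apply sum_f_R0_trunc; [exact Hk|].
    intros m Hm. rewrite ps_pow_low; [ring|apply phi_0|exact Hm]. }
  assert (E2 : sum_f_R0 (fun m => sinh_coef alpha m * ps_pow (phi alpha) m k) (S l)
     = sum_f_R0 (fun m => trunc2 (sinh_coef alpha) m * ps_pow (phi alpha) m k) (S l)
       + phi alpha k).
  { rewrite sum_trunc2, ps_pow_1. unfold sinh_coef at 2 3, odd_ind. simpl. field. }
  unfold Pcoef at 2.
  replace ((INR k ^ 2 - 1) * (phi alpha k * ps_pow (wcoef b) k (S l))) with
    (ps_pow (wcoef b) k (S l) *
     sum_f_R0 (fun m => trunc2 (sinh_coef alpha) m * ps_pow (phi alpha) m k) (S l)).
  - rewrite <- sum_f_R0_scal_l. apply sum_eq. intros m _. rewrite pow2_Pcoef. ring.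
  - replace (sum_f_R0 _ (S l)) with (INR k ^ 2 * phi alpha k - phi alpha k)
      by (rewrite <- E, E2; ring). ring.
Qed.

(* Since [(cos^k)'' = k (k - 1) cos^(k - 2) - k^2 cos^k], the equation at order
   [cos^k * exp (- l xi)] reads
   [mu l k * p l k = comp2 g p l k + kappa k * p l (k + 2)],
   with [mu] and [kappa] both nonnegative as soon as [l >= 2] and [k >= 1]. *)
Definition mu (eps : R) (l k : nat) : R :=
  (1 - eps ^ 2) * INR k ^ 2 + eps ^ 2 * INR l ^ 2 - 1.

(** For [k >= 1] the value is at least [eps ^ 2 * (INR l ^ 2 - 1)]. *)
Lemma mu_pos eps l k : 0 < eps < 1 -> (2 <= l)%nat -> (1 <= k)%nat -> 0 < mu eps l k.
Proof.
  intros He Hl Hk. unfold mu.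
  apply le_INR in Hl. apply le_INR in Hk. simpl in Hl, Hk.
  assert (1 <= INR k ^ 2) by nra. assert (4 <= INR l ^ 2) by nra.
  assert (0 < eps ^ 2 < 1) by nra. nra.
Qed.

Definition kappa (eps : R) (k : nat) : R := (1 - eps ^ 2) * ((INR k + 2) * (INR k + 1)).

Lemma kappa_ge_0 eps k : 0 < eps < 1 -> 0 <= kappa eps k.
Proof.
  intros He. pose proof (pos_INR k). unfold kappa. apply Rmult_le_pos; nra.
Qed.

(** Once the nonlinear term is replaced by its value, [eps ^ 2 * (l ^ 2 - k ^ 2) * P l k = kappa eps
    k * P l (k + 2)] remains. This is [wpow_rec], given [(1 - eps ^ 2) * b ^ 2 = eps ^ 2] and
    [(k + 2) * phi_(k+2) = k * phi_k]. *)
Lemma Pcoef_rec alpha eps l k :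
  0 < alpha -> 0 < eps < 1 -> (1 <= k)%nat ->
  let P := Pcoef alpha (eps / sqrt (1 - eps ^ 2)) in
  mu eps l k * P l k =
  comp2 (trunc2 (sinh_coef alpha)) P l k + kappa eps k * P l (k + 2)%nat.
Proof.
  intros Ha He Hk P. unfold P. rewrite comp2_sinh_Pcoef by exact Ha.
  set (b := eps / sqrt (1 - eps ^ 2)).
  assert (H1 : 0 < 1 - eps ^ 2) by nra.
  assert (Hb : 0 < b) by (apply Rdiv_lt_0_compat; [lra|now apply sqrt_lt_R0]).
  assert (Hb2 : (1 - eps ^ 2) * b ^ 2 = eps ^ 2).
  { unfold b. unfold Rdiv. rewrite Rpow_mult_distr, pow_inv, pow2_sqrt by lra. field. lra. }
  assert (Hphi : (INR k + 2) * phi alpha (k + 2)%nat = INR k * phi alpha k).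
  { replace (INR k + 2) with (INR (k + 2)) by (rewrite plus_INR; simpl; ring).
    change (ps_euler (phi alpha) (k + 2) = ps_euler (phi alpha) k).
    rewrite !euler_phi. unfold odd_ind. rewrite Nat.odd_add. 
    destruct (Nat.odd k); reflexivity. }
  assert (HW := wpow_rec b k l Hb Hk).
  unfold mu, kappa, Pcoef.
  set (W0 := ps_pow (wcoef b) k l) in *. set (W2 := ps_pow (wcoef b) (k + 2) l) in *.
  replace ((1 - eps ^ 2) * ((INR k + 2) * (INR k + 1)) * (phi alpha (k + 2) * W2))
    with ((1 - eps ^ 2) * (((INR k + 2) * phi alpha (k + 2)%nat) * (INR k + 1) * W2)) by ring.
  rewrite Hphi.
  replace ((1 - eps ^ 2) * (INR k * phi alpha k * (INR k + 1) * W2))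
    with ((1 - eps ^ 2) * (phi alpha k * (INR k * (INR k + 1) * W2))) by ring.
  rewrite <- HW.
  replace ((1 - eps ^ 2) * (phi alpha k * (b ^ 2 * (INR l ^ 2 - INR k ^ 2) * W0)))
    with (((1 - eps ^ 2) * b ^ 2) * (phi alpha k * ((INR l ^ 2 - INR k ^ 2) * W0))) by ring.
  rewrite Hb2. ring.
Qed.

(* Solves [mu k * x k = r k + kappa k * x (k + 2)] downwards in [k], starting from
   [x (k + 2 * fuel) = 0]. *)
Fixpoint descend (eps : R) (l : nat) (r : nat -> R) (fuel k : nat) : R :=
  match fuel with
  | O => 0
  | S fuel => (r k + kappa eps k * descend eps l r fuel (k + 2)) / mu eps l k
  end.

(** For odd [k] both recursions share a positive divisor and a nonnegative [kappa], so the bound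
    descends from [k + 2] to [k]. *)
Lemma descend_bound eps l (r P rho : nat -> R) fuel k :
  0 < eps < 1 -> (2 <= l)%nat ->
  (forall k, 0 <= P k) ->
  (forall k, Nat.odd k = false -> P k = 0) ->
  (forall k, Rabs (r k) <= rho k) ->
  (forall k, Nat.odd k = false -> rho k = 0) ->
  (forall k, (1 <= k)%nat -> mu eps l k * P k = rho k + kappa eps k * P (k + 2)%nat) ->
  Rabs (descend eps l r fuel k) <= P k.
Proof.
  intros He Hl HP HPe Hr Hre Hrec. revert k.
  induction fuel as [|fuel IH]; intros k; simpl; [rewrite Rabs_R0; apply HP|].
  set (x := descend eps l r fuel (k + 2)) in *.
  assert (Hx : Rabs x <= P (k + 2)%nat) by apply IH.
  destruct (Nat.odd k) eqn:Hk.
  - assert (Hk1 : (1 <= k)%nat) by (destruct k; [discriminate|lia]).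
    assert (Hm := mu_pos eps l k He Hl Hk1).
    unfold Rdiv. rewrite Rabs_mult, Rabs_inv, (Rabs_pos_eq (mu eps l k)) by lra.
    apply Rmult_le_reg_r with (mu eps l k); [exact Hm|].
    rewrite Rmult_assoc, Rinv_l, Rmult_1_r, (Rmult_comm (P k)), Hrec by (lra || lia).
    eapply Rle_trans; [apply Rabs_triang|]. apply Rplus_le_compat; [apply Hr|].
    rewrite Rabs_mult, (Rabs_pos_eq (kappa eps k)) by now apply kappa_ge_0.
    apply Rmult_le_compat_l; [now apply kappa_ge_0|exact Hx].
  (* For even [k] the divisor may vanish (at [k = 0]); the numerator is 0, hence so is the quotient,
     whatever the divisor. *)
  - assert (E1 : r k = 0).
    { specialize (Hr k). rewrite Hre in Hr by exact Hk.
      now apply Rabs_eq_0, Rle_antisym; [|apply Rabs_pos]. }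
    assert (E2 : x = 0).
    { rewrite HPe in Hx by (rewrite Nat.odd_add, Hk; reflexivity).
      now apply Rabs_eq_0, Rle_antisym; [|apply Rabs_pos]. }
    rewrite E1, E2. unfold Rdiv. rewrite Rmult_0_r, Rplus_0_l, Rmult_0_l, Rabs_R0.
    apply HP.
Qed.

(** Each step raises [k] by 2, and beyond [l] additional fuel meets only zero right-hand sides. *)
Lemma descend_stable eps l (r : nat -> R) fuel k :
  (forall k, (l < k)%nat -> r k = 0) -> (l < k + fuel)%nat ->
  descend eps l r fuel k = descend eps l r (S fuel) k.
Proof.
  intros Hr. revert k. induction fuel as [|fuel IH]; intros k Hk.
  - simpl. rewrite Hr by lia. unfold Rdiv. ring.
  - change ((r k + kappa eps k * descend eps l r fuel (k + 2)) / mu eps l k =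
      (r k + kappa eps k * descend eps l r (S fuel) (k + 2)) / mu eps l k).
    rewrite IH by lia. reflexivity.
Qed.

Lemma descend_ext eps l (r r' : nat -> R) fuel k :
  (forall k, r k = r' k) -> descend eps l r fuel k = descend eps l r' fuel k.
Proof.
  intros H. revert k. induction fuel as [|fuel IH]; intros k; simpl; [reflexivity|].
  now rewrite H, IH.
Qed.

(** Row [l] is determined by the rows below it, but that recursion is not structural; it is iterated
    from the zero array instead. Row 1 is prescribed, and fuel [S l] carries [k] beyond [l]. *)
Definition picard (eps : R) (g : nat -> R) (P A : nat -> nat -> R) (l k : nat) : R :=
  if (l <=? 1)%nat then P l k else descend eps l (comp2 g A l) (S l) k.

Definition picard_iter eps g P n : nat -> nat -> R :=
  Nat.iter n (picard eps g P) (fun _ _ => 0).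

Lemma Rabs_le_0 x : Rabs x <= 0 -> x = 0.
Proof. intros H. apply Rabs_eq_0, Rle_antisym; [exact H|apply Rabs_pos]. Qed.

Lemma coef_exist (alpha eps : R) (g : nat -> R) :
  0 < alpha -> 0 < eps < 1 ->
  (forall m, Rabs (g m) <= trunc2 (sinh_coef alpha) m) ->
  let P := Pcoef alpha (eps / sqrt (1 - eps ^ 2)) in
  exists p : nat -> nat -> R,
    (forall l k, Rabs (p l k) <= P l k) /\
    (forall k, p 1%nat k = P 1%nat k) /\
    (forall l k, mu eps l k * p l k = comp2 g p l k + kappa eps k * p l (k + 2)%nat).
Proof.
  intros Ha He Hg P.
  assert (Hb : 0 < eps / sqrt (1 - eps ^ 2)).
  { apply Rdiv_lt_0_compat; [lra|]. apply sqrt_lt_R0. nra. }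
  assert (HP : forall l k, 0 <= P l k) by (intros; now apply Pcoef_pos).
  assert (g0 : g 0%nat = 0) by (apply Rabs_le_0; exact (Hg 0%nat)).
  assert (g1 : g 1%nat = 0) by (apply Rabs_le_0; exact (Hg 1%nat)).
  assert (Bc : forall A, (forall l k, Rabs (A l k) <= P l k) ->
      forall l k, Rabs (comp2 g A l k) <= comp2 (trunc2 (sinh_coef alpha)) P l k).
  { intros A HA l k. now apply comp2_abs. }
  assert (Ev : forall l k, Nat.odd k = false -> comp2 (trunc2 (sinh_coef alpha)) P l k = 0).
  { intros l k Hk. unfold P. rewrite comp2_sinh_Pcoef, Pcoef_even by assumption. ring. }
  assert (Inv : forall A, (forall l k, Rabs (A l k) <= P l k) ->
      forall l k, Rabs (picard eps g P A l k) <= P l k).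
  { intros A HA l k. unfold picard. destruct (Nat.leb_spec l 1).
    - rewrite Rabs_pos_eq; [lra|apply HP].
    - apply (descend_bound eps l _ (P l) (comp2 (trunc2 (sinh_coef alpha)) P l)); auto.
      + intros; now apply Pcoef_even.
      + intros; now apply Pcoef_rec. }
  set (it := picard_iter eps g P).
  assert (Itb : forall n l k, Rabs (it n l k) <= P l k).
  { induction n as [|n IH]; [intros; simpl; rewrite Rabs_R0; apply HP|].
    exact (Inv _ IH). }
  assert (Z0 : forall A, (forall l k, Rabs (A l k) <= P l k) -> forall k, A 0%nat k = 0).
  { intros A HA k. apply Rabs_le_0. rewrite <- (Pcoef_l0 alpha (eps / sqrt (1 - eps ^ 2)) k).
    apply HA. }
  assert (Loc : forall A B l,
      (forall l k, Rabs (A l k) <= P l k) -> (forall l k, Rabs (B l k) <= P l k) ->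
      (forall j k, (j < l)%nat -> A j k = B j k) ->
      forall k, picard eps g P A l k = picard eps g P B l k).
  { intros A B l HA HB H k. unfold picard. destruct (Nat.leb l 1); [reflexivity|].
    apply descend_ext. intros; apply comp2_eq_below; auto. }
  (* Row [l] is stationary from iterate [l + 1] on, so the diagonal [p] below is a fixed point of
     [picard]. *)
  assert (St : forall l n n', (l < n)%nat -> (l < n')%nat -> forall k, it n l k = it n' l k).
  { induction l as [l IH] using (well_founded_induction lt_wf).
    intros [|n] [|n'] Hn Hn' k; try lia.
    apply (Loc (it n) (it n')); auto. intros j i Hj. apply IH; lia. }
  set (p := fun l k => it (S l) l k).
  assert (Hp : forall l k, Rabs (p l k) <= P l k) by (intros; apply Itb).
  assert (Fix : forall l k, p l k = picard eps g P p l k).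
  { intros l k. apply (Loc (it l) p); auto. intros j i Hj. apply St; lia. }
  assert (Sup : forall l k, (l < k)%nat -> p l k = 0).
  { intros l k Hk. apply Rabs_le_0.
    rewrite <- (Pcoef_support alpha (eps / sqrt (1 - eps ^ 2)) l k Hk). apply Hp. }
  assert (Evp : forall l k, Nat.odd k = false -> p l k = 0).
  { intros l k Hk. apply Rabs_le_0.
    rewrite <- (Pcoef_even alpha (eps / sqrt (1 - eps ^ 2)) l k Hk). apply Hp. }
  exists p. split; [exact Hp|split].
  - intros k. rewrite Fix. reflexivity.
  - intros l k. destruct (Nat.odd k) eqn:Hk.
    + assert (Hk1 : (1 <= k)%nat) by (destruct k; [discriminate|lia]).
      destruct (Nat.lt_ge_cases 1 l) as [Hl|Hl].
      * assert (Hm := mu_pos eps l k He Hl Hk1).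
        rewrite (Fix l k), (Fix l (k + 2)%nat). unfold picard.
        destruct (Nat.leb_spec l 1); [lia|].
        (* Unfolding [p l k] leaves fuel [l] at [k + 2], one less than in [p l (k + 2)]. *)
        rewrite <- (descend_stable _ _ _ l (k + 2)).
        -- simpl descend. field. lra.
        -- intros; now apply comp2_support.
        -- lia.
      (* Rows 0 and 1 were not defined by the recursion. Among odd [k] only [p 1 1] can be nonzero
         there, and [mu eps 1 1 = 0]. *)
      * assert (E : comp2 g p l k = 0).
        { apply sum_f_R0_zero. intros [|[|m]] Hm'; [rewrite g0|rewrite g1|lia]; ring. }
        rewrite E, (Sup l (k + 2)%nat) by lia.
        destruct (Nat.eq_dec l 1) as [->|]; [|rewrite Sup by lia; ring].
        destruct (Nat.eq_dec k 1) as [->|]; [|rewrite Sup by lia; ring].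
        unfold mu. simpl. ring.
    + rewrite (Evp l k Hk), (Evp l (k + 2)%nat) by (rewrite Nat.odd_add, Hk; reflexivity).
      replace (comp2 g p l k) with 0; [ring|]. symmetry. apply Rabs_le_0.
      rewrite <- (Ev l k Hk). now apply Bc.
Qed.

(** * Domain of convergence and differentiation *)

(** The mean value inequality bounds the difference quotients by [K]. A bound uniform in [t] is
    available because this serves the variable [tau], which enters through sines and cosines. *)
Lemma is_derive_Series_dom (f f' : nat -> R -> R) (K : nat -> R) (x : R) :
  (forall n t, is_derive (f n) t (f' n t)) ->
  (forall n t, Rabs (f' n t) <= K n) ->
  ex_series K ->
  (forall t, ex_series (fun n => f n t)) ->
  is_derive (fun t => Series (fun n => f n t)) x (Series (fun n => f' n x)).
Proof.
  intros Hd HK EK Ef. apply is_derive_Reals. intros e He.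
  set (F := fun h n => (f n (x + h) - f n x) / h).
  assert (L : filterlim (fun h => Series (F h)) (Rbar_locally' 0)
                (locally (Series (fun n => f' n x)))).
  { apply (@filterlim_Series_dom R (Rbar_locally' 0) (Rbar_locally'_filter 0) F _ K);
      [| |exact EK].
    - intros n. apply filterlim_locally. intros d.
      destruct (proj1 (is_derive_Reals _ _ _) (Hd n x) d (cond_pos d)) as [r Hr].
      exists r. intros h Hh Hh0. apply Hr; [exact Hh0|].
      change (Rabs (h - 0) < r) in Hh. now rewrite Rminus_0_r in Hh.
    - exists posreal_one. intros h _ Hh n. unfold F, Rdiv.
      rewrite Rabs_mult, Rabs_inv.
      assert (B := bounded_variation (f n) (f' n) (K n) x (x + h)).
      rewrite (Rplus_minus_l x h) in B.
      apply Rmult_le_reg_r with (Rabs h); [now apply Rabs_pos_lt|].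
      rewrite Rmult_assoc, Rinv_l, Rmult_1_r by now apply Rabs_no_R0.
      apply B. intros t _. split; [apply Hd|apply HK]. }
  destruct (proj1 (filterlim_locally _ _) L (mkposreal e He)) as [r Hr].
  exists r. intros h Hh0 Hh.
  specialize (Hr h).
  assert (Hb : ball 0 r h) by (change (Rabs (h - 0) < r); now rewrite Rminus_0_r).
  specialize (Hr Hb Hh0).
  change (Rabs (Series (F h) - Series (fun n => f' n x)) < e) in Hr.
  rewrite <- Series_minus by apply Ef.
  replace (Series (F h)) with (Series (fun n => f n (x + h) - f n x) / h) in Hr; [exact Hr|].
  symmetry. apply (Series_scal_r (/ h)).
Qed.

Lemma PSeries_bound (a P : nat -> R) n c :
  (forall k, Rabs (a k) <= P k) -> (forall k, (n < k)%nat -> P k = 0) -> Rabs c <= 1 ->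
  Rabs (PSeries a c) <= PSeries P 1.
Proof.
  intros Ha HP Hc.
  assert (B : forall k, Rabs (a k * c ^ k) <= P k).
  { intros k. rewrite Rabs_mult, <- RPow_abs. rewrite <- (Rmult_1_r (P k)).
    apply Rmult_le_compat; auto using Rabs_pos.
    - apply pow_le, Rabs_pos.
    - rewrite <- (pow1 k). apply pow_incr. split; [apply Rabs_pos|exact Hc]. }
  assert (E : ex_series P) by (eexists; now apply (is_series_finite P n)).
  rewrite PSeries_1. unfold PSeries.
  eapply Rle_trans; [apply Series_Rabs|apply Series_le; auto using Rabs_pos].
  apply ex_series_dom with P; [|exact E]. intros k; rewrite Rabs_Rabsolu; apply B.
Qed.

(** * The majorant series: its sum, its link with [ubar], its domain *)

Lemma wfun_pos b q : 0 < b -> 0 <= q < 1 -> 0 <= wfun b q.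
Proof.
  intros Hb Hq. unfold wfun. apply Rmult_le_pos; [lra|].
  apply Rdiv_le_0_compat; nra.
Qed.

(** With [c] absorbed in the outer coefficients [phi alpha k * c ^ k], the composition with [w] has
    as coefficients the rows evaluated at [c]. Since [w >= 0], absolute convergence only asks for
    [Rabs (c * w) < 1]. *)
Lemma is_pseries_Pcoef alpha b c q :
  0 < alpha -> 0 < b -> 0 <= q < 1 -> Rabs (c * wfun b q) < 1 ->
  is_pseries (fun l => PSeries (Pcoef alpha b l) c) q (PSeries (phi alpha) (c * wfun b q)).
Proof.
  intros Ha Hb Hq Hc.
  assert (Hq' : Rabs q < 1) by (rewrite Rabs_pos_eq; lra).
  assert (Hw := is_pseries_wcoef b q Hq').
  assert (HS : Series (fun n => Rabs (wcoef b n * q ^ n)) = wfun b q).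
  { rewrite <- (is_pseries_unique _ _ _ Hw). apply Series_ext. intros n.
    apply Rabs_pos_eq, Rmult_le_pos; [now apply wcoef_pos|apply pow_le; lra]. }
  apply is_pseries_R.
  apply is_series_ext with (fun l => ps_comp (fun k => phi alpha k * c ^ k) (wcoef b) l * q ^ l).
  - intros l. f_equal. symmetry. apply is_pseries_unique, is_pseries_R.
    apply is_series_ext with (fun k => phi alpha k * c ^ k * ps_pow (wcoef b) k l).
    + intros k.
      change (phi alpha k * c ^ k * ps_pow (wcoef b) k l =
        phi alpha k * ps_pow (wcoef b) k l * c ^ k). ring.
    + apply is_series_finite. intros k Hk.
      rewrite ps_pow_low; [ring|apply wcoef_0|exact Hk].
  - apply is_pseries_R.
    replace (PSeries (phi alpha) (c * wfun b q))
      with (PSeries (fun k => phi alpha k * c ^ k) (PSeries (wcoef b) q)).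
    + apply is_pseries_ps_comp.
      * apply wcoef_0.
      * now apply ex_series_wcoef.
      * rewrite HS.
        apply ex_series_ext with (fun k => Rabs (phi alpha k * (c * wfun b q) ^ k)).
        -- intros k. rewrite Rpow_mult_distr, <- Rmult_assoc, Rabs_mult. f_equal.
           apply Rabs_pos_eq, pow_le. now apply wfun_pos.
        -- apply CV_disk_inside, CV_radius_phi; lra.
    + rewrite (is_pseries_unique _ _ _ Hw). apply Series_ext. intros k.
      rewrite Rpow_mult_distr. ring.
Qed.

Lemma RtoC_pos_neq x : 0 < x -> RtoC x <> 0%C.
Proof. intros Hx E. apply RtoC_inj in E. lra. Qed.

Lemma Ci_neq_0 : Ci <> 0%C.
Proof. intros E. injection E. lra. Qed.

Lemma Clog_pos x : 0 < x -> Clog (RtoC x) = RtoC (ln x).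
Proof.
  intros Hx. unfold Clog, Carg. rewrite Cmod_R, Rabs_pos_eq by lra.
  unfold RtoC. simpl. f_equal.
  replace (x / x) with 1 by (field; lra). rewrite acos_1.
  destruct (Rle_dec 0 0); lra.
Qed.

(** The argument of the arctangent is [y / Ci], so both logarithms are taken at the positive reals
    [1 + y] and [1 - y], where the principal branch is the real logarithm. *)
Lemma u_SHG_phi alpha eps tau xi :
  let b := eps / sqrt (1 - eps ^ 2) in
  0 < alpha -> 0 < xi -> Rabs (cos tau * wfun b (exp (- xi))) < 1 ->
  u_SHG alpha eps tau xi = RtoC (PSeries (phi alpha) (cos tau * wfun b (exp (- xi)))).
Proof.
  intros b Ha Hxi Hy.
  rewrite PSeries_phi by (exact Hy || lra).
  assert (Hs : 0 < sinh xi) by (rewrite <- sinh_0; now apply sinh_lt).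
  set (y := cos tau * wfun b (exp (- xi))) in *.
  assert (Ey : y = b * (cos tau / sinh xi)).
  { unfold y, wfun, sinh. unfold sinh in Hs. rewrite exp_Ropp in *.
    pose proof (exp_pos xi). assert (1 < exp xi) by (rewrite <- exp_0; now apply exp_increasing).
    field. split; nra. }
  assert (E : (RtoC b * (RtoC (cos tau) / (Ci * RtoC (sinh xi))) = RtoC y / Ci)%C).
  { rewrite Ey, RtoC_mult, RtoC_div by lra. field.
    split; [now apply RtoC_pos_neq|apply Ci_neq_0]. }
  unfold u_SHG. fold b. rewrite E. unfold Carctan.
  replace (1 + Ci * (RtoC y / Ci))%C with (RtoC (1 + y))
    by (rewrite RtoC_plus; field; apply Ci_neq_0).
  replace (1 - Ci * (RtoC y / Ci))%C with (RtoC (1 - y))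
    by (rewrite RtoC_minus; field; apply Ci_neq_0).
  apply Rabs_def2 in Hy.
  rewrite !Clog_pos by lra.
  rewrite RtoC_mult, RtoC_minus, RtoC_div by lra.
  field. split; [now apply RtoC_pos_neq|apply Ci_neq_0].
Qed.

(** The constant gives [2 * b * q <= 1 / 2 - q], which lies below [1 - q ^ 2]. *)
Lemma wfun_small b q : 0 < b -> 0 <= q <= / (2 + 4 * b) -> q < 1 /\ 0 <= wfun b q < 1.
Proof.
  intros Hb [Hq0 Hq].
  assert (Hq' : q * (2 + 4 * b) <= 1).
  { apply Rmult_le_compat_r with (r := 2 + 4 * b) in Hq; [|lra].
    rewrite Rinv_l in Hq; lra. }
  assert (Hq1 : q < 1) by nra.
  split; [exact Hq1|split; [apply wfun_pos; lra|]].
  unfold wfun. assert (Hd : 0 < 1 - q ^ 2) by nra.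
  apply Rmult_lt_reg_r with (1 - q ^ 2); [exact Hd|].
  replace (2 * b * (q / (1 - q ^ 2)) * (1 - q ^ 2)) with (2 * b * q) by (field; lra).
  nra.
Qed.

Lemma Rabs_cos_mult_lt tau x : 0 <= x < 1 -> Rabs (cos tau * x) < 1.
Proof.
  intros Hx. rewrite Rabs_mult, (Rabs_pos_eq x) by lra.
  assert (Rabs (cos tau) <= 1) by (apply Rabs_le, COS_bound). 
  pose proof (Rabs_pos (cos tau)). nra.
Qed.

Lemma exp_neg_pow n xi : exp (- INR n * xi) = exp (- xi) ^ n.
Proof.
  induction n as [|n IH]; [simpl; rewrite Ropp_0, Rmult_0_l; apply exp_0|].
  rewrite S_INR. simpl. rewrite <- IH, <- exp_plus. f_equal. ring.
Qed.

Lemma ubar_coef (alpha eps : R) (ubar : nat -> R -> R) tau l :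
  0 < alpha -> 0 < eps < 1 -> is_exp_expansion ubar (u_SHG alpha eps) -> (1 <= l)%nat ->
  ubar l tau = PSeries (Pcoef alpha (eps / sqrt (1 - eps ^ 2)) l) (cos tau).
Proof.
  intros Ha He Hub Hl. set (b := eps / sqrt (1 - eps ^ 2)).
  assert (Hb : 0 < b) by (apply Rdiv_lt_0_compat; [lra|apply sqrt_lt_R0; nra]).
  destruct (Hub tau) as [M HM].
  (* [q < exp (- M)] means [- ln q > M], where the expansion holds; the second bound keeps
     [wfun b q < 1]. *)
  assert (Hr : 0 < Rmin (exp (- M)) (/ (2 + 4 * b))).
  { apply Rmin_glb_lt; [apply exp_pos|apply Rinv_0_lt_compat; lra]. }
  (* [ubar 0] is arbitrary and is replaced by 0, the constant term of the series. *)
  set (a := fun n => match n with O => 0 | S _ => ubar n tau end).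
  cut (a l = PSeries (Pcoef alpha b l) (cos tau)).
  { unfold a. destruct l; [lia|trivial]. }
  revert l Hl. cut (forall l, a l = PSeries (Pcoef alpha b l) (cos tau)); [auto|].
  apply (pseries_unique_right _ _ (fun q => PSeries (phi alpha) (cos tau * wfun b q)) _ Hr).
  - intros q [Hq0 Hq].
    assert (Hq1 := Rlt_le_trans _ _ _ Hq (Rmin_l _ _)).
    assert (Hq2 := Rlt_le_trans _ _ _ Hq (Rmin_r _ _)).
    destruct (wfun_small b q Hb) as [Hq3 Hw]; [lra|].
    assert (Eq : exp (- - ln q) = q) by (rewrite Ropp_involutive; now apply exp_ln).
    assert (Hxi : 0 < - ln q) by (apply Ropp_0_gt_lt_contravar; rewrite <- ln_1; now apply ln_increasing).
    destruct (HM (- ln q)) as [s [Hs1 Hs2]].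
    { apply Ropp_lt_cancel. rewrite Ropp_involutive. apply exp_lt_inv. now rewrite exp_ln. }
    rewrite u_SHG_phi in Hs2; [|exact Ha|exact Hxi|].
    2:{ rewrite Eq. now apply Rabs_cos_mult_lt. }
    fold b in Hs2. rewrite Eq in Hs2. apply RtoC_inj in Hs2. rewrite Hs2.
    apply is_pseries_R. apply is_series_decr_1.
    change (is_series (fun k => ubar (S k) tau * q ^ (S k)) (s + - (0 * 1))).
    rewrite Rmult_0_l, Ropp_0, Rplus_0_r.
    apply is_series_ext with (2 := Hs1). intros n. unfold exp_term.
    now rewrite exp_neg_pow, Eq.
  - intros q [Hq0 Hq].
    assert (Hq2 := Rlt_le_trans _ _ _ Hq (Rmin_r _ _)).
    destruct (wfun_small b q Hb) as [Hq3 Hw]; [lra|].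
    apply is_pseries_Pcoef; try assumption; [lra|]. now apply Rabs_cos_mult_lt.
Qed.

Lemma wfun_surj b t : 0 < b -> 0 < t -> exists q, 0 < q < 1 /\ wfun b q = t.
Proof.
  (* [wfun b q = t] is the quadratic [s * q ^ 2 + 2 * q - s = 0], whose positive root is
     [s / (1 + r)]. *)
  intros Hb Ht. set (s := t / b). set (r := sqrt (1 + s ^ 2)).
  assert (Hs : 0 < s) by now apply Rdiv_lt_0_compat.
  assert (Hr2 : r ^ 2 = 1 + s ^ 2) by (apply pow2_sqrt; nra).
  assert (Hr0 : 0 <= r) by apply sqrt_pos.
  assert (Hr : s < r) by nra.
  exists (s / (1 + r)). split.
  - split; [apply Rdiv_lt_0_compat; lra|].
    apply Rmult_lt_reg_r with (1 + r); [lra|]. unfold Rdiv.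
    rewrite Rmult_assoc, Rinv_l; lra.
  - unfold wfun.
    replace (1 - (s / (1 + r)) ^ 2) with (2 / (1 + r)).
    + replace t with (s * b) by (unfold s; field; lra). field. lra.
    + replace ((s / (1 + r)) ^ 2) with ((r ^ 2 - 1) / (1 + r) ^ 2) by (rewrite Hr2; field; lra).
      field. lra.
Qed.

(* The sum at [wfun b q = t] is [phi t], unbounded as [t] tends to 1; so
   convergence at [q0] forces [wfun b q0 < 1]. *)
Lemma Pcoef_domain alpha b q0 :
  0 < alpha -> 0 < b -> 0 < q0 ->
  ex_series (fun l => PSeries (Pcoef alpha b l) 1 * q0 ^ l) ->
  exists q, q0 < q < 1 /\ wfun b q < 1.
Proof.
  intros Ha Hb Hq0 E.
  set (M := fun l => PSeries (Pcoef alpha b l) 1).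
  assert (HM : forall l, 0 <= M l).
  { intros l. eapply Rle_trans; [apply Rabs_pos|].
    apply (PSeries_bound (Pcoef alpha b l) (Pcoef alpha b l) l 0).
    - intros k. rewrite Rabs_pos_eq; [lra|now apply Pcoef_pos].
    - intros; now apply Pcoef_support.
    - rewrite Rabs_R0; lra. }
  set (S := Series (fun l => M l * q0 ^ l)).
  assert (HS : 0 <= S).
  { assert (H := sum_le_Series (fun l => M l * q0 ^ l) 0). simpl in H.
    eapply Rle_trans; [|apply H; [|exact E]].
    - specialize (HM 0%nat). lra.
    - intros k. apply Rmult_le_pos; [apply HM|apply pow_le; lra]. }
  (* Chosen so that [- (2 / alpha) * ln d = S + 1], which makes the majorant sum at [w = 1 - d]
     exceed [S]. *)
  set (d := exp (- (alpha / 2 * (S + 1)))).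
  assert (Hd0 : 0 < d) by apply exp_pos.
  assert (Hd1 : d < 1).
  { rewrite <- exp_0. apply exp_increasing. assert (0 < alpha / 2) by lra. nra. }
  destruct (wfun_surj b (1 - d) Hb) as [q [Hq Hwq]]; [lra|].
  exists q. rewrite Hwq. split; [split; [|lra]|lra].
  (* Were [q <= q0], nonnegative coefficients would bound the sum at [q] by [S]. *)
  apply Rnot_le_lt. intros Hle.
  assert (Hy : Rabs (1 * wfun b q) < 1) by (rewrite Rmult_1_l, Hwq, Rabs_pos_eq; lra).
  assert (H := is_pseries_Pcoef alpha b 1 q Ha Hb ltac:(lra) Hy).
  rewrite PSeries_phi in H by (exact Hy || lra).
  rewrite Rmult_1_l, Hwq in H.
  apply is_pseries_unique in H.
  assert (L : PSeries M q <= S).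
  { apply Series_le; [|exact E]. intros n.
    assert (0 <= q ^ n <= q0 ^ n) by (split; [apply pow_le; lra|apply pow_incr; lra]).
    specialize (HM n). split; [apply Rmult_le_pos; lra|apply Rmult_le_compat_l; lra]. }
  unfold M in L at 1. rewrite H in L.
  replace (1 - (1 - d)) with d in L by ring. unfold d in L at 2. rewrite ln_exp in L.
  assert (L2 : 0 <= ln (1 + (1 - d))).
  { rewrite <- ln_1. apply Rlt_le, ln_increasing; lra. }
  assert (L3 : 0 <= 2 / alpha * ln (1 + (1 - d))).
  { apply Rmult_le_pos; [|exact L2]. apply Rlt_le, Rdiv_lt_0_compat; lra. }
  replace (2 / alpha * (ln (1 + (1 - d)) - - (alpha / 2 * (S + 1))))
    with (2 / alpha * ln (1 + (1 - d)) + (S + 1)) in L by (field; lra).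
  lra.
Qed.

(** * Second derivatives of series in [exp (- x)] and of polynomials in [cos t] *)

Lemma is_derive_PSeries_exp (a : nat -> R) x :
  Rbar_lt (Rabs (exp (- x))) (CV_radius a) ->
  is_derive (fun x => PSeries a (exp (- x))) x (- PSeries (ps_euler a) (exp (- x))).
Proof.
  intros H. rewrite PSeries_euler.
  replace (- (exp (- x) * PSeries (PS_derive a) (exp (- x))))
    with (scal (- exp (- x)) (PSeries (PS_derive a) (exp (- x)))).
  - apply (is_derive_comp (PSeries a) (fun x => exp (- x))).
    + now apply is_derive_PSeries.
    + auto_derive; [trivial|ring].
  - change (- exp (- x) * PSeries (PS_derive a) (exp (- x)) =
      - (exp (- x) * PSeries (PS_derive a) (exp (- x)))). ring.
Qed.

Lemma derive2_of (f f' : R -> R) x l :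
  locally x (fun y => is_derive f y (f' y)) -> is_derive f' x l ->
  ex_derive f x /\ ex_derive_n f 2 x /\ Derive_n f 2 x = l.
Proof.
  intros H1 H2.
  assert (H3 : is_derive (Derive f) x l).
  { apply is_derive_ext_loc with (2 := H2). revert H1. apply filter_imp.
    intros y Hy. symmetry. now apply is_derive_unique. }
  split; [|split].
  - eexists. exact (locally_singleton _ _ H1).
  - exists l. exact H3.
  - now apply is_derive_unique.
Qed.

Lemma exp_sum_PSeries (u : nat -> R -> R) tau xi :
  u 0%nat tau = 0 ->
  exp_sum u tau xi = PSeries (fun l => u l tau) (exp (- xi)).
Proof.
  intros H. unfold PSeries. rewrite Series_incr_1_aux by (rewrite H; ring).
  apply Series_ext. intros n. unfold exp_term. now rewrite exp_neg_pow.
Qed.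

(** The gap between [q] and [r] absorbs the factor [INR n ^ 2] that two derivatives cost. *)
Lemma ex_series_euler2 (a : nat -> R) q r : 0 <= q < r ->
  ex_series (fun n => a n * r ^ n) -> ex_series (fun n => INR n ^ 2 * a n * q ^ n).
Proof.
  intros Hq E.
  apply ex_series_ext with (fun n => ps_euler (ps_euler a) n * q ^ n).
  - intros n. unfold ps_euler.
    change (INR n * (INR n * a n) * q ^ n = INR n ^ 2 * a n * q ^ n). ring.
  - apply ex_pseries_R, CV_radius_inside. rewrite !CV_radius_euler.
    apply CV_radius_gt_ex with r; [rewrite Rabs_pos_eq; lra|exact E].
Qed.

(** For [f (cos t)] the second derivative is [(1 - c ^ 2) f'' - c f'], that is [f'' - (c d/dc)^2 f],
    whose coefficients are immediate. *)
Lemma cos_poly_derive2 (a : nat -> R) n t :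
  (forall k, (n < k)%nat -> a k = 0) ->
  is_derive (fun t => - sin t * PSeries (PS_derive a) (cos t)) t
    (PSeries (fun k => (INR k + 2) * (INR k + 1) * a (k + 2)%nat - INR k ^ 2 * a k) (cos t)).
Proof.
  intros Ha.
  assert (R0 : forall x, Rbar_lt (Rabs x) (CV_radius a)).
  { intros x; now apply CV_radius_gt_finite with n. }
  assert (R1 : forall x, Rbar_lt (Rabs x) (CV_radius (PS_derive a))).
  { intros x; now rewrite CV_radius_derive. }
  set (c := cos t). set (a1 := PS_derive a). set (a2 := PS_derive a1).
  assert (D1 : is_derive (fun t => PSeries a1 (cos t)) t (- sin t * PSeries a2 c)).
  { apply (is_derive_comp (PSeries a1) cos).
    - now apply is_derive_PSeries.
    - apply is_derive_Reals, derivable_pt_lim_cos. }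
  assert (D : is_derive (fun t => - sin t * PSeries a1 (cos t)) t
     (- cos t * PSeries a1 c + - sin t * (- sin t * PSeries a2 c))).
  { apply (is_derive_mult (fun t => - sin t) (fun t => PSeries a1 (cos t))); [|exact D1|intros; apply Rmult_comm].
    auto_derive; [trivial|ring]. }
  replace (PSeries _ c) with (- cos t * PSeries a1 c + - sin t * (- sin t * PSeries a2 c));
    [exact D|].
  replace (- sin t * (- sin t * PSeries a2 c)) with ((1 - c ^ 2) * PSeries a2 c).
  2:{ unfold c. pose proof (sin2_cos2 t). unfold Rsqr in *.
      replace (1 - cos t ^ 2) with (sin t * sin t) by lra. ring. }
  fold c.
  assert (E0 : PSeries (ps_euler a) c = c * PSeries a1 c) by apply PSeries_euler.
  assert (E1 : PSeries (ps_euler (ps_euler a)) c = c * PSeries a1 c + c ^ 2 * PSeries a2 c).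
  { rewrite PSeries_euler.
    assert (Dx : is_derive (PSeries (ps_euler a)) c (1 * PSeries a1 c + c * PSeries a2 c)).
    { apply is_derive_ext with (fun x => x * PSeries a1 x).
      - intros x. symmetry. apply PSeries_euler.
      - apply (is_derive_mult (fun x => x) (PSeries a1)); [auto_derive; trivial| |intros; apply Rmult_comm].
        now apply is_derive_PSeries. }
    apply is_derive_unique in Dx.
    rewrite Derive_PSeries in Dx by (rewrite CV_radius_euler; apply R0).
    rewrite Dx. ring. }
  replace (- c * PSeries a1 c + (1 - c ^ 2) * PSeries a2 c)
    with (PSeries a2 c - PSeries (ps_euler (ps_euler a)) c) by (rewrite E1; ring).
  rewrite <- PSeries_minus.
  - apply PSeries_ext. intros k. unfold PS_minus, PS_plus, PS_opp, ps_euler, a2, a1, PS_derive.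
    replace (k + 2)%nat with (S (S k)) by lia. rewrite !S_INR.
    change (((INR k + 1) * ((INR k + 1 + 1) * a (S (S k)))) + - (INR k * (INR k * a k)) =
      (INR k + 2) * (INR k + 1) * a (S (S k)) - INR k ^ 2 * a k). ring.
  - apply CV_radius_inside. unfold a2. rewrite CV_radius_derive. apply R1.
  - apply CV_radius_inside. rewrite !CV_radius_euler. apply R0.
Qed.

(** * The solution *)

Lemma odd_PSeries_coef (g : nat -> R) n :
  (forall x, Rbar_lt (Rabs x) (CV_radius g)) ->
  (forall x, PSeries g (- x) = - PSeries g x) -> Nat.odd n = false -> g n = 0.
Proof.
  intros Hg Hodd Hn.
  assert (E : (1 - 2 * odd_ind n) * g n = - g n).
  { apply (pseries_unique_disk (fun n => (1 - 2 * odd_ind n) * g n) (PS_opp g)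
      (fun x => - PSeries g x) 1 Rlt_0_1).
    - intros x _. rewrite <- Hodd. apply is_pseries_R.
      apply is_series_ext with (fun n => g n * (- x) ^ n).
      + intros k. rewrite pow_neg_odd_ind.
        change (g k * ((1 - 2 * odd_ind k) * x ^ k) = (1 - 2 * odd_ind k) * g k * x ^ k). ring.
      + apply is_pseries_R, PSeries_correct, CV_radius_inside, Hg.
    - intros x _. apply (is_pseries_opp g).
      apply PSeries_correct, CV_radius_inside, Hg. }
  unfold odd_ind in E. rewrite Hn in E. lra.
Qed.

Lemma Rabs_cos_le t : Rabs (cos t) <= 1.
Proof. apply Rabs_le, COS_bound. Qed.

Lemma INR_sqr_le l k : (k <= l)%nat -> 0 <= INR k ^ 2 <= INR l ^ 2.
Proof. intros H. apply le_INR in H. pose proof (pos_INR k). nra. Qed.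

Section Solution.

Variables (alpha eps : R) (g : nat -> R) (p : nat -> nat -> R).
Hypothesis alpha_pos : 0 < alpha.
Hypothesis eps_range : 0 < eps < 1.
Hypothesis g_entire : forall x, Rbar_lt (Rabs x) (CV_radius g).
Hypothesis g_maj : forall m, Rabs (trunc2 g m) <= trunc2 (sinh_coef alpha) m.
Let P := Pcoef alpha (eps / sqrt (1 - eps ^ 2)).
Hypothesis p_maj : forall l k, Rabs (p l k) <= P l k.
Hypothesis p_rec : forall l k,
  mu eps l k * p l k = comp2 (trunc2 g) p l k + kappa eps k * p l (k + 2)%nat.

Let M (l : nat) : R := PSeries (P l) 1.
Let U (l : nat) (t : R) : R := PSeries (p l) (cos t).

Lemma p_support l k : (l < k)%nat -> p l k = 0.
Proof.
  intros H. apply Rabs_le_0.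
  rewrite <- (Pcoef_support alpha (eps / sqrt (1 - eps ^ 2)) l k H). apply p_maj.
Qed.

Lemma U_bound l t : Rabs (U l t) <= M l.
Proof.
  apply PSeries_bound with l; [apply p_maj| |apply Rabs_cos_le].
  intros; now apply Pcoef_support.
Qed.

Lemma U_0 t : U 0 t = 0.
Proof.
  unfold U. rewrite (PSeries_ext _ (fun _ => 0)); [apply PSeries_const_0|].
  intros k. apply Rabs_le_0. rewrite <- (Pcoef_l0 alpha (eps / sqrt (1 - eps ^ 2)) k).
  apply p_maj.
Qed.

Let U1 (l : nat) (t : R) : R := - sin t * PSeries (PS_derive (p l)) (cos t).
Let dd (l k : nat) : R := (INR k + 2) * (INR k + 1) * p l (k + 2)%nat - INR k ^ 2 * p l k.
Let U2 (l : nat) (t : R) : R := PSeries (dd l) (cos t).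
Let N (l : nat) (t : R) : R := PSeries (comp2 (trunc2 g) p l) (cos t).

Lemma U_derive l t : is_derive (U l) t (U1 l t).
Proof.
  apply (is_derive_comp (PSeries (p l)) cos).
  - apply is_derive_PSeries, CV_radius_gt_finite with l. apply p_support.
  - apply is_derive_Reals, derivable_pt_lim_cos.
Qed.

Lemma U1_derive l t : is_derive (U1 l) t (U2 l t).
Proof. apply cos_poly_derive2 with l. apply p_support. Qed.

Lemma one_minus_eps2_pos : 0 < 1 - eps ^ 2.
Proof. nra. Qed.

Lemma b_pos : 0 < eps / sqrt (1 - eps ^ 2).
Proof. apply Rdiv_lt_0_compat; [lra|]. apply sqrt_lt_R0, one_minus_eps2_pos. Qed.

Lemma P_pos l k : 0 <= P l k.
Proof. apply Pcoef_pos; [exact alpha_pos|apply b_pos]. Qed.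

(** Degree at most [l] costs one factor [INR l]; the square is stated so that a single summable
    sequence dominates all the terms. *)
Lemma U1_bound l t : Rabs (U1 l t) <= INR l ^ 2 * M l.
Proof.
  unfold U1. rewrite Rabs_mult, Rabs_Ropp.
  assert (HM : 0 <= M l) by (eapply Rle_trans; [apply Rabs_pos|apply (U_bound l t)]).
  assert (Hs : Rabs (sin t) <= 1) by (apply Rabs_le, SIN_bound).
  assert (B : Rabs (PSeries (PS_derive (p l)) (cos t)) <= INR l * M l).
  { apply Rle_trans with (PSeries (PS_derive (P l)) 1).
    - apply PSeries_bound with l; [| |apply Rabs_cos_le].
      + intros k. unfold PS_derive. rewrite Rabs_mult, (Rabs_pos_eq (INR (S k))) by apply pos_INR.
        apply Rmult_le_compat_l; [apply pos_INR|apply p_maj].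
      + intros k Hk. unfold PS_derive, P. rewrite Pcoef_support by lia. ring.
    - rewrite <- (Rmult_1_l (PSeries (PS_derive (P l)) 1)), <- PSeries_euler.
      unfold M. rewrite <- PSeries_scal. eapply Rle_trans; [apply Rle_abs|].
      apply PSeries_bound with l; [| |rewrite Rabs_R1; lra].
      + intros k. change (Rabs (INR k * P l k) <= INR l * P l k).
        rewrite Rabs_pos_eq by (apply Rmult_le_pos; [apply pos_INR|apply P_pos]).
        destruct (Nat.le_gt_cases k l) as [H|H].
        * apply Rmult_le_compat_r; [apply P_pos|now apply le_INR].
        * unfold P. rewrite Pcoef_support by exact H. lra.
      + intros k Hk. change (INR l * P l k = 0). unfold P.
        rewrite Pcoef_support by exact Hk. ring. }
  assert (Hl : INR l <= INR l ^ 2).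
  { destruct l; [simpl; lra|]. assert (1 <= INR (S l)) by (apply (le_INR 1); lia). nra. }
  pose proof (Rabs_pos (sin t)).
  pose proof (Rabs_pos (PSeries (PS_derive (p l)) (cos t))).
  nra.
Qed.

(** The sinh nonlinearity majorizes this one and equals [(k ^ 2 - 1) * P l k], with [k <= l]. *)
Lemma N_bound l t : Rabs (N l t) <= INR l ^ 2 * M l.
Proof.
  unfold M. rewrite <- PSeries_scal.
  apply PSeries_bound with l; [| |apply Rabs_cos_le].
  - intros k. change (Rabs (comp2 (trunc2 g) p l k) <= INR l ^ 2 * P l k).
    destruct (Nat.le_gt_cases k l) as [H|H].
    + eapply Rle_trans; [now apply comp2_abs|]. unfold P at 1.
      rewrite comp2_sinh_Pcoef by exact alpha_pos. fold P.
      apply Rmult_le_compat_r; [apply P_pos|]. pose proof (INR_sqr_le l k H). lra.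
    + rewrite comp2_support by (exact H || exact p_support).
      unfold P. rewrite Pcoef_support by exact H. rewrite Rabs_R0. lra.
  - intros k Hk. change (INR l ^ 2 * P l k = 0). unfold P.
    rewrite Pcoef_support by exact Hk. ring.
Qed.

(** The equation at order [exp (- l xi)], solved for the second derivative: it provides the bound on
    [U2] and, summed over [l], the final identity. *)
Lemma U_equation l t :
  U2 l t = / (1 - eps ^ 2) * (eps ^ 2 * (INR l ^ 2 * U l t) - U l t - N l t).
Proof.
  pose proof one_minus_eps2_pos as He.
  set (s := (eps ^ 2 * INR l ^ 2 - 1)).
  assert (E1 : ex_pseries (p l) (cos t)).
  { apply CV_radius_inside, CV_radius_gt_finite with l. apply p_support. }
  assert (E2 : ex_pseries (comp2 (trunc2 g) p l) (cos t)).
  { apply CV_radius_inside, CV_radius_gt_finite with l. intros.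
    apply comp2_support; auto using p_support. }
  replace (eps ^ 2 * (INR l ^ 2 * U l t) - U l t - N l t) with (s * U l t - N l t)
    by (unfold s; ring).
  unfold U2, U, N. rewrite <- PSeries_scal, <- PSeries_minus, <- PSeries_scal.
  - apply PSeries_ext. intros k.
    change (dd l k = / (1 - eps ^ 2) * (s * p l k + - comp2 (trunc2 g) p l k)).
    apply Rmult_eq_reg_l with (1 - eps ^ 2); [|lra].
    rewrite <- Rmult_assoc, Rinv_r, Rmult_1_l by lra.
    generalize (p_rec l k). unfold dd, s, mu, kappa. lra.
  - apply (ex_pseries_scal (K:=R_AbsRing) (V:=R_NormedModule)); [apply Rmult_comm|exact E1].
  - exact E2.
Qed.

Lemma U2_bound l t : Rabs (U2 l t) <= / (1 - eps ^ 2) * (2 * (INR l ^ 2 * M l) + M l).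
Proof.
  pose proof one_minus_eps2_pos as He.
  rewrite U_equation, Rabs_mult, Rabs_pos_eq by (apply Rlt_le, Rinv_0_lt_compat; exact He).
  apply Rmult_le_compat_l; [apply Rlt_le, Rinv_0_lt_compat; exact He|].
  pose proof (U_bound l t) as HU. pose proof (N_bound l t) as HN.
  assert (Hl : 0 <= INR l ^ 2) by apply pow2_ge_0.
  assert (HM : 0 <= M l) by (eapply Rle_trans; [apply Rabs_pos|exact HU]).
  assert (A : Rabs (eps ^ 2 * (INR l ^ 2 * U l t)) <= INR l ^ 2 * M l).
  { rewrite !Rabs_mult, !(Rabs_pos_eq (_ ^ 2)) by apply pow2_ge_0.
    assert (0 <= INR l ^ 2 * Rabs (U l t) <= INR l ^ 2 * M l).
    { split; [apply Rmult_le_pos; auto using Rabs_pos|now apply Rmult_le_compat_l]. }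
    assert (0 < eps ^ 2 < 1) by nra. nra. }
  unfold Rminus. eapply Rle_trans; [apply Rabs_triang|].
  eapply Rle_trans; [apply Rplus_le_compat_r, Rabs_triang|]. rewrite !Rabs_Ropp. lra.
Qed.

Lemma p_solution xi r :
  exp (- xi) < r -> ex_series (fun l => M l * r ^ l) ->
  convergence_domain U xi /\ forall tau, solves_at eps g (exp_sum U) tau xi.
Proof.
  intros Hr EM. pose proof one_minus_eps2_pos as He.
  set (q := exp (- xi)) in *.
  assert (Hq : 0 < q) by apply exp_pos.
  assert (Hqr : Rabs q < r) by (rewrite Rabs_pos_eq; lra).
  assert (E0 : ex_series (fun l => M l * q ^ l)).
  { apply ex_pseries_R, CV_radius_inside. now apply CV_radius_gt_ex with r. }
  assert (E2 : ex_series (fun l => INR l ^ 2 * M l * q ^ l)).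
  { apply ex_series_euler2 with r; [lra|exact EM]. }
  assert (Dom : forall (f : nat -> R -> R) (K : nat -> R), (forall l t, Rabs (f l t) <= K l) ->
     forall l t, Rabs (f l t * q ^ l) <= K l * q ^ l).
  { intros f K H l t. assert (0 < q ^ l) by now apply pow_lt.
    rewrite Rabs_mult, (Rabs_pos_eq (q ^ l)) by lra.
    apply Rmult_le_compat_r; [lra|apply H]. }
  assert (EU : forall t, ex_series (fun l => Rabs (U l t * q ^ l))).
  { intros t. apply ex_series_dom with (2 := E0). intros l. rewrite Rabs_Rabsolu.
    apply (Dom U M U_bound). }
  assert (HV : forall t x, exp_sum U t x = PSeries (fun l => U l t) (exp (- x))).
  { intros t x. apply exp_sum_PSeries, U_0. }
  split.
  { intros t. assert (E := proj1 (ex_series_incr_1 _) (ex_series_Rabs _ (EU t))).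
    apply ex_series_ext with (2 := E). intros n. unfold exp_term.
    rewrite exp_neg_pow. reflexivity. }
  intros t.
  assert (Ht : ex_derive (fun t => exp_sum U t xi) t /\
     ex_derive_n (fun t => exp_sum U t xi) 2 t /\
     Derive_n (fun t => exp_sum U t xi) 2 t = Series (fun l => U2 l t * q ^ l)).
  { apply derive2_of with (fun t => Series (fun l => U1 l t * q ^ l)).
    - apply filter_forall. intros s.
      apply is_derive_ext with (fun t => Series (fun l => U l t * q ^ l)).
      { intros y. now rewrite HV. }
      apply (is_derive_Series_dom (fun l t => U l t * q ^ l) (fun l t => U1 l t * q ^ l)
        (fun l => INR l ^ 2 * M l * q ^ l)).
      + intros l y. apply (is_derive_scal_l (V:=R_NormedModule) (U l)). apply U_derive.
      + apply (Dom U1 (fun l => INR l ^ 2 * M l) U1_bound).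
      + exact E2.
      + intros y. apply ex_series_Rabs, EU.
    - apply (is_derive_Series_dom (fun l t => U1 l t * q ^ l) (fun l t => U2 l t * q ^ l)
        (fun l => / (1 - eps ^ 2) * (2 * (INR l ^ 2 * M l) + M l) * q ^ l)).
      + intros l y. apply (is_derive_scal_l (V:=R_NormedModule) (U1 l)). apply U1_derive.
      + apply (Dom U2 (fun l => / (1 - eps ^ 2) * (2 * (INR l ^ 2 * M l) + M l)) U2_bound).
      + apply ex_series_ext with (fun l => / (1 - eps ^ 2) *
          (2 * (INR l ^ 2 * M l * q ^ l) + M l * q ^ l)).
        { intros l.
          change (/ (1 - eps ^ 2) * (2 * (INR l ^ 2 * M l * q ^ l) + M l * q ^ l) =
            / (1 - eps ^ 2) * (2 * (INR l ^ 2 * M l) + M l) * q ^ l). ring. }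
        apply (ex_series_scal_l (V:=R_NormedModule)).
        apply (ex_series_plus (V:=R_NormedModule)); [|exact E0].
        apply (ex_series_scal_l (V:=R_NormedModule)). exact E2.
      + intros y. apply ex_series_dom with (2 := E2). intros l.
        apply (Dom U1 (fun l => INR l ^ 2 * M l) U1_bound). }
  assert (Hx : ex_derive (fun x => exp_sum U t x) xi /\
     ex_derive_n (fun x => exp_sum U t x) 2 xi /\
     Derive_n (fun x => exp_sum U t x) 2 xi =
       PSeries (ps_euler (ps_euler (fun l => U l t))) q).
  { set (a := fun l => U l t).
    assert (Ra : forall x, Rabs (exp (- x)) < r -> Rbar_lt (Rabs (exp (- x))) (CV_radius a)).
    { intros x Hx. apply CV_radius_gt_ex with r; [exact Hx|].
      apply ex_series_dom with (2 := EM). intros l.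
      assert (0 < r ^ l) by (apply pow_lt; lra).
      rewrite Rabs_mult, (Rabs_pos_eq (r ^ l)) by lra.
      apply Rmult_le_compat_r; [lra|apply U_bound]. }
    apply derive2_of with (fun x => - PSeries (ps_euler a) (exp (- x))).
    (* The first derivative must be known near [xi], and [exp (- x) < r] persists there. *)
    - assert (C : continuous (fun x => exp (- x)) xi).
      { apply (ex_derive_continuous (K:=R_AbsRing) (V:=R_NormedModule)). auto_derive. trivial. }
      generalize (C _ (open_lt r q Hr)). unfold filtermap. apply filter_imp.
      intros x Hx. apply is_derive_ext with (fun x => PSeries a (exp (- x))).
      { intros y. now rewrite HV. }
      apply is_derive_PSeries_exp, Ra. rewrite Rabs_pos_eq; [exact Hx|apply Rlt_le, exp_pos].
    - rewrite <- (Ropp_involutive (PSeries (ps_euler (ps_euler a)) q)).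
      apply (is_derive_opp (fun x => PSeries (ps_euler a) (exp (- x)))).
      apply is_derive_PSeries_exp. rewrite CV_radius_euler. now apply Ra. }
  destruct Ht as [Ht1 [Ht2 Ht3]]. destruct Hx as [Hx1 [Hx2 Hx3]].
  unfold solves_at. split; [now split|split; [now split|]].
  rewrite Ht3, Hx3, HV. fold q.
  set (v := PSeries (fun l => U l t) q).
  (* Substitution of the absolutely convergent series for [v] into the entire nonlinearity. *)
  assert (HN : is_series (fun l => N l t * q ^ l) (PSeries (trunc2 g) v)).
  { apply is_series_ext with (fun l => ps_comp (trunc2 g) (fun l => U l t) l * q ^ l).
    - intros l. f_equal. apply ps_comp_eval. exact p_support.
    - apply is_pseries_R, is_pseries_ps_comp.
      + apply U_0.
      + apply EU.
      + apply entire_ex_series.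
        * intros x. apply ex_pseries_R.
          apply ex_series_dom with (2 := CV_disk_inside g x (g_entire x)).
          intros [|[|m]]; simpl trunc2; rewrite ?Rmult_0_l, ?Rabs_R0; try apply Rabs_pos.
          apply Rle_refl.
        * eapply Rle_trans; [apply Rabs_pos|]. apply (Series_Rabs (fun l => U l t * q ^ l)), EU. }
  assert (EN : ex_series (fun l => N l t * q ^ l)) by (eexists; exact HN).
  apply is_series_unique in HN.
  replace (Series (fun m => g (m + 2)%nat * v ^ (m + 2))) with (PSeries (trunc2 g) v).
  2:{ unfold PSeries. rewrite (Series_incr_n_aux _ 2).
      - apply Series_ext. intros m. now rewrite (Nat.add_comm m 2).
      - intros [|[|k]] Hk; simpl; [ring|ring|lia]. }
  assert (EX : ex_series (fun l => INR l ^ 2 * U l t * q ^ l)).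
  { apply ex_series_dom with (2 := E2). intros l.
    apply (Dom (fun l t => INR l ^ 2 * U l t) (fun l => INR l ^ 2 * M l)).
    intros l' t'. rewrite Rabs_mult, (Rabs_pos_eq (_ ^ 2)) by apply pow2_ge_0.
    apply Rmult_le_compat_l; [apply pow2_ge_0|apply U_bound]. }
  replace (PSeries (ps_euler (ps_euler (fun l => U l t))) q)
    with (Series (fun l => INR l ^ 2 * U l t * q ^ l)).
  2:{ apply Series_ext. intros l. unfold ps_euler. ring. }
  replace (Series (fun l => U2 l t * q ^ l)) with
    (/ (1 - eps ^ 2) * (eps ^ 2 * Series (fun l => INR l ^ 2 * U l t * q ^ l)
        - v - PSeries (trunc2 g) v)).
  { field. lra. }
  assert (EU' : ex_series (fun l => U l t * q ^ l)) by apply ex_series_Rabs, EU.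
  assert (EX' := ex_series_scal_l (V:=R_NormedModule) (eps ^ 2) _ EX).
  assert (EM' := ex_series_minus (V:=R_NormedModule) _ _ EX' EU').
  rewrite <- HN. unfold v, PSeries. rewrite <- Series_scal_l, <- !Series_minus by assumption.
  rewrite <- Series_scal_l. apply Series_ext. intros l. rewrite U_equation. ring.
Qed.

End Solution.

Theorem theorem4 (g : nat -> R) (alpha eps : R) (ubar : nat -> R -> R)
    (g_entire : CV_radius g = p_infty)
    (g_at_0 : PSeries g 0 = 0)
    (g'_at_0 : is_derive (PSeries g) 0 1)
    (g_odd : forall x : R, PSeries g (- x) = - PSeries g x)
    (alpha_pos : 0 < alpha)
    (g_bound : forall m : nat, (1 <= m)%nat ->
       Rabs (g m) <= alpha ^ (m - 1) / INR (fact m))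
    (eps_range : 0 < eps < 1)
    (ubar_expansion : is_exp_expansion ubar (u_SHG alpha eps)) :
  exists u : nat -> R -> R,
    (forall tau : R, u 1%nat tau = ubar 1%nat tau) /\
    (forall (l : nat) (tau : R), (1 <= l)%nat ->
       u l (tau + 2 * PI) = u l tau) /\
    (forall xi : R, convergence_domain ubar xi ->
       convergence_domain u xi /\
       forall tau : R, solves_at eps g (exp_sum u) tau xi).
Proof.
  assert (g_ent : forall x, Rbar_lt (Rabs x) (CV_radius g)) by (intros; now rewrite g_entire).
  assert (g_maj : forall m, Rabs (trunc2 g m) <= trunc2 (sinh_coef alpha) m).
  { intros [|[|m]]; [simpl; rewrite Rabs_R0; lra..|].
    change (Rabs (g (S (S m))) <= sinh_coef alpha (S (S m))).
    unfold sinh_coef, odd_ind. destruct (Nat.odd (S (S m))) eqn:Hm.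
    - rewrite Rmult_1_l. apply g_bound. lia.
    - rewrite (odd_PSeries_coef g _ g_ent g_odd Hm), Rabs_R0. lra. }
  destruct (coef_exist alpha eps (trunc2 g) alpha_pos eps_range g_maj) as [p [Hp [Hp1 Hrec]]].
  exists (fun l t => PSeries (p l) (cos t)). split; [|split].
  - intros tau.
    rewrite (ubar_coef alpha eps ubar tau 1 alpha_pos eps_range ubar_expansion) by lia.
    now apply PSeries_ext.
  - intros l tau _. now rewrite cos_plus, cos_2PI, sin_2PI, Rmult_1_r, Rmult_0_r, Rminus_0_r.
  - intros xi Hxi.
    set (b := eps / sqrt (1 - eps ^ 2)) in *.
    assert (Hb : 0 < b) by now apply b_pos.
    (* Only [tau = 0] is used: there [cos tau = 1] and the series of [ubar] is the majorant. *)
    destruct (Pcoef_domain alpha b (exp (- xi)) alpha_pos Hb (exp_pos _)) as [r [Hr Hw]].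
    { apply ex_series_incr_1. apply ex_series_ext with (2 := Hxi 0).
      intros n. unfold exp_term.
      rewrite (ubar_coef alpha eps ubar 0 (S n) alpha_pos eps_range ubar_expansion) by lia.
      now rewrite exp_neg_pow, cos_0. }
    pose proof (exp_pos (- xi)).
    apply (p_solution alpha eps g p alpha_pos eps_range g_ent g_maj Hp Hrec xi r);
      [lra|].
    eexists. apply is_pseries_R. apply is_pseries_Pcoef; [exact alpha_pos|exact Hb|lra|].
    fold b. rewrite Rmult_1_l, Rabs_pos_eq; [exact Hw|]. apply wfun_pos; [exact Hb|lra].
Qed.
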